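(* Let $p\ge 1$ be a fixed positive integer. For each positive integer $N$, let $T_{N(1)},\dots,T_{N(p)}$ be independent random variables, each distributed as the number of trials needed to detect all $N$ types at least once in the coupon collector's problem with $N$ equally likely types, and let $M_{N(p)}:=\min_{1\le i\le p}T_{N(i)}$. Then $$E\left[M_{N(p)}^{2}\right]=2\sum_{k=0}^{\infty}k\left(1-S(k,N)\frac{N!}{N^{k}}\right)^{p}-E\left[M_{N(p)}\right],$$ where $S(k,N)$ are the Stirling numbers of the second kind. In particular, as $N\rightarrow\infty$, $$E\left[M_{N(p)}^{2}\right]=N^{2}\left[(\ln N)^{2}+2\left(\gamma+p\,c_{p}\right)\ln N+\gamma^{2}+\frac{\pi^{2}}{6}+2p\,c_{p}\gamma+p\,w_{p}+O\left(\frac{(\ln N)^{3}}{N}\right)\right],$$ where $\gamma$ is the Euler--Mascheroni constant and $c_p$, $w_p$ are the constants given explicitly by $$c_{p}:=\sum_{j=0}^{p-1}(-1)^{j}\binom{p-1}{j}\frac{\ln(1+j)}{j+1},\qquad w_{p}:=\sum_{j=0}^{p-1}(-1)^{j}\binom{p-1}{j}\frac{\left(\ln(1+j)\right)^{2}}{j+1}.$$ Moreover, for the variance of the random variable $M_{N(p)}$, as $N\rightarrow\infty$, $$V\left[M_{N(p)}\right]\sim\left(\frac{\pi^{2}}{6}+p\,w_{p}-p^{2}c_{p}^{2}\right)N^{2}.$$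
   Context: Coupon collector's problem with uniform probabilities: a collector samples independently with replacement, each trial yielding one of $N$ types, each type with probability $1/N$. The number of trials needed is the index of the first trial at which every one of the $N$ types has been observed at least once. The $p$ collectors sample independently of each other, and $T_{N(i)}$ is this number of trials for the $i$-th collector. $S(k,N)$ is the number of partitions of a set of $k$ labeled objects into $N$ nonempty unlabeled subsets, i.e. $S(k,N)=\frac{1}{N!}\sum_{n=0}^{N}(-1)^{N-n}\binom{N}{n}n^{k}$; in particular $S(k,N)=0$ for $k<N$. The number $p$ is fixed as $N\to\infty$. The notation $f(N)\sim g(N)$ means $f(N)/g(N)\to 1$ as $N\to\infty$.
   Formalization: The printed identity for E[M²] is false (for N=1 its left side is 1 and its right side is −1); the formal theorem proves it with +E[M] in place of −E[M], and the asymptotic claims are unchanged. *)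

(* Defs.v *)
From HB Require Import structures.
From mathcomp Require Import all_boot all_order all_algebra finmap.
From mathcomp Require Import all_classical all_reals all_analysis.

Set Implicit Arguments.
Unset Strict Implicit.
Unset Printing Implicit Defensive.

Import Order.TTheory GRing.Theory Num.Theory.
Import numFieldNormedType.Exports.

Local Open Scope classical_set_scope.
Local Open Scope ring_scope.

Definition mutually_independent (d : measure_display) (Om : measurableType d)
    (R : realType) (P : probability Om R) (I : choiceType)
    (E : I -> set (set Om)) : Prop :=
  forall (J : {fset I}) (A : I -> set Om),
    (forall i, i \in J -> E i (A i)) ->
    P (\bigcap_(i in [set` J]) A i) = (\prod_(i <- J) P (A i))%E.

(* [Y k w] is the type obtained at the [k.+1]-th trial: trials are numbered
   from 0. *)
Definition uniform_draws (d : measure_display) (Om : measurableType d)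
    (R : realType) (P : probability Om R) (N : nat)
    (Y : nat -> Om -> 'I_N) : Prop :=
  [/\ forall k c, measurable (Y k @^-1` [set c]),
      forall k c, P (Y k @^-1` [set c]) = (N%:R^-1)%:E
    & mutually_independent P
        (fun k => [set Y k @^-1` C | C in [set: set 'I_N]])].

Definition all_types_seen (Om : Type) (N : nat) (Y : nat -> Om -> 'I_N)
    (n : nat) (w : Om) : Prop :=
  forall c : 'I_N, exists2 k, (k < n)%N & Y k w = c.

(* The least [n] such that the first [n] trials show all types; it is [+oo]
   when some type never shows up. *)
Definition collection_time (R : realType) (Om : Type) (N : nat)
    (Y : nat -> Om -> 'I_N) (w : Om) : \bar R :=
  ereal_inf [set n%:R%:E | n in [set n | all_types_seen Y n w]].

(* The real random variable [T] has the law of the collection time of some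
   collector; that collector may live on another probability space. *)
Definition has_collection_law (d : measure_display) (Om : measurableType d)
    (R : realType) (P : probability Om R) (N : nat) (T : {RV P >-> R}) : Prop :=
  exists (d' : measure_display) (Om' : measurableType d')
         (P' : probability Om' R) (Y : nat -> Om' -> 'I_N),
    uniform_draws P' Y /\
    forall B, measurable B ->
      distribution P T B =
      P' [set w | exists2 r : R, B r & collection_time R Y w = r%:E].

Definition min_rv (Om : Type) (R : realType) (p : nat) (hp : (0 < p)%N)
    (T : 'I_p -> Om -> R) (w : Om) : R :=
  \big[Num.min/T (Ordinal hp) w]_(i < p) T i w.

Definition stirling2 (k N : nat) : nat :=
  #|[set Q : {set {set 'I_k}} | finset.partition Q [set: 'I_k] & #|Q| == N]%SET|.

Definition euler_gamma (R : realType) : R :=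
  limn (fun n => \sum_(1 <= k < n.+1) k%:R^-1 - ln n%:R : R).

Definition c_const (R : realType) (p : nat) : R :=
  \sum_(j < p) (-1) ^+ j * 'C(p.-1, j)%:R * (ln j.+1%:R / j.+1%:R).

Definition w_const (R : realType) (p : nat) : R :=
  \sum_(j < p) (-1) ^+ j * 'C(p.-1, j)%:R * (ln j.+1%:R ^+ 2 / j.+1%:R).

(* Main.v *)
(* For [p = 1] both moments are exact: with [F N k = P(T_N <= k)] and [H] the
   harmonic numbers, Dynkin's formula for the number of missing types gives
   E T_N = N H_N and E T_N^2 = N^2 (H_N^2 + H_N^(2)) - N H_N.

   For general [p], inclusion-exclusion writes (1 - F)^p as the combination
   sum_j (-1)^j C(p, j+1) (1 - F^(j+1)).  The second difference of [F N] is at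
   most 2/N^2, so smoothing [F N] by a binomial variable of mean [k] (in the
   Poisson limit) costs O(k / N^2), and the smoothed function is exactly
   (1 - exp(-k/N))^N.  Its [j]-th power is the same function for [j N] types at
   time [j k], hence F N k ^ j is close to F (jN) (jk): each term reduces to an
   exact moment of T_{jN}, up to a relative error O((ln N)^3 / N).  It remains to
   expand H_n = ln n + gamma + O(1/n) and H_n^(2) = pi^2/6 + O(1/n).

   The limiting variance is nonzero because the atoms of the minimum have mass
   at most p/N, so that by Chebyshev's inequality the variance is at least a
   constant times N^2. *)
Require Import Defs.
From HB Require Import structures.
From mathcomp Require Import all_boot all_order all_algebra finmap.
From mathcomp Require Import all_classical all_reals all_analysis.
From mathcomp Require Import measurable_realfun ring lra.

Set Implicit Arguments.
Unset Strict Implicit.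
Unset Printing Implicit Defensive.

Import Order.TTheory GRing.Theory Num.Theory.
Import numFieldNormedType.Exports.

Local Open Scope classical_set_scope.
Local Open Scope ring_scope.

(** * Occupancy numbers *)

(** The smoothing error O(k / N^2) is not summable in k, so the sums over times [m] of the enlarged
    collection, with n = j N types, are cut at K = 8 n ln n. Below K there are O(N ln N) terms, each
    with an error O((ln N) / N). The weights 2m + 1 are O(N ln N) there, so the second moment is off
    by O(N (ln N)^3), the stated relative error; with weights 1 the mean is off by O((ln N)^2).
    Beyond K both functions are within a constant times 1 / m^3 of 1, and the rest of the sum stays
    bounded.

    The power F N k ^ j only matches the enlarged collection at the times j k. Every [m] is
    therefore compared with the integer quotient [m %/ j]: over a block of j consecutive [m] the
    weights 1 and 2m + 1 add up to exactly j and j^2 (2k + 1), so the summation itself introduces no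
    discretisation error.

    The survival weights are P(M > k) = (1 - F N k)^p. As (k + 1)^2 - k^2 = 2k + 1, E M^2 is the sum
    of (2k + 1) P(M > k), so that E M enters the first identity with a plus sign; a minus sign would
    go with P(M >= k). *)

Section Occupancy.
Variable R : realFieldType.
Implicit Types (N k i j r : nat) (h : nat -> R).

(* [occ N k i] is the probability that [k] uniform draws among [N] types show
   exactly [i] distinct types. *)
Fixpoint occ N k i : R :=
  if k is k'.+1 then
    i%:R / N%:R * occ N k' i +
    (if i is i'.+1 then (N - i')%:R / N%:R * occ N k' i' else 0)
  else (i == 0)%:R.

Definition full N k : R := occ N k N.

Lemma occ_ge0 N k i : 0 <= occ N k i.
Proof.
elim: k i => [|k IHk] i /=; first exact: ler0n.
apply: addr_ge0; first by rewrite mulr_ge0// divr_ge0.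
by case: i => // i; rewrite mulr_ge0// divr_ge0.
Qed.

(** The forward recursion is moved onto the test function [h]: this is the transition operator of
    the chain. The value [h N.+1] is harmless, its coefficient being 0. Eigenfunctions and both
    moment formulas are obtained by choosing [h]. *)
Lemma occ_step N k h : (0 < N)%N ->
  \sum_(i < N.+1) occ N k.+1 i * h i =
  \sum_(i < N.+1) occ N k i *
    (i%:R / N%:R * h i + (N - i)%:R / N%:R * h i.+1).
Proof.
move=> N0 /=.
under eq_bigr do rewrite mulrDl.
rewrite big_split/=.
under [RHS]eq_bigr do rewrite mulrDr.
rewrite [RHS]big_split/=; congr (_ + _).
  by apply: eq_bigr => i _; ring.
rewrite big_ord_recl /= mul0r add0r.
rewrite [RHS]big_ord_recr /= subnn mul0r mul0r mulr0 addr0.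
by apply: eq_bigr => i _; rewrite /bump/= add1n; ring.
Qed.

Lemma occ_sum N k : (0 < N)%N -> \sum_(i < N.+1) occ N k i = 1.
Proof.
move=> N0; elim: k => [|k IHk].
  by rewrite big_ord_recl big1 ?addr0.
have := @occ_step N k (fun=> 1) N0.
under eq_bigr do rewrite mulr1.
move=> ->; rewrite -[RHS]IHk; apply: eq_bigr => i _.
have iN : (i <= N)%N by rewrite -ltnS.
rewrite natrB// -[RHS]mulr1; congr (_ * _); field.
by rewrite pnatr_eq0 -lt0n.
Qed.

Lemma occ_le1 N k i : (i <= N)%N -> (0 < N)%N -> occ N k i <= 1.
Proof.
move=> iN N0; rewrite -(occ_sum k N0).
rewrite -ltnS in iN; rewrite (bigD1 (Ordinal iN))//= lerDl.
by apply: sumr_ge0 => l _; exact: occ_ge0.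
Qed.

(* The binomials in the number of missing types are eigenfunctions of the
   occupancy chain. *)
Lemma sum_occ_bin N k j : (0 < N)%N ->
  \sum_(i < N.+1) occ N k i * 'C(N - i, j)%:R =
  'C(N, j)%:R * (1 - j%:R / N%:R) ^+ k.
Proof.
move=> N0; have N0R : N%:R != 0 :> R by rewrite pnatr_eq0 -lt0n.
elim: k => [|k IHk].
  rewrite big_ord_recl /= subn0 mul1r big1 ?addr0 ?expr0 ?mulr1// => i _.
  by rewrite mul0r.
rewrite (occ_step _ (fun i => 'C(N - i, j)%:R)) // exprS mulrCA -IHk mulr_sumr.
apply: eq_bigr => i _.
have iN : (i <= N)%N by rewrite -ltnS.
rewrite mulrCA; congr (_ * _).
have -> : i%:R = N%:R - (N - i)%:R :> R by rewrite natrB// opprB addrC subrK.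
have -> : (N - i.+1 = (N - i).-1)%N by rewrite subnS.
case: (N - i)%N => [|r] /=.
  rewrite !mul0r addr0 subr0 divff// mul1r.
  by case: j {IHk} => [|j]; [rewrite mul0r subr0 mul1r | rewrite bin0n/= mulr0].
have : r.+1%:R * 'C(r, j)%:R = (r.+1%:R - j%:R) * 'C(r.+1, j)%:R :> R.
  have [jr|jr] := leqP j r.+1.
    by rewrite -natrB// -!natrM mul_bin_down.
  by rewrite !bin_small ?mulr0// ltnW.
move=> E; rewrite [X in _ + X]mulrAC E.
by field.
Qed.

Lemma alternating_bin r : \sum_(j < r.+1) (-1) ^+ j * 'C(r, j)%:R = (r == 0)%:R :> R.
Proof.
have := exprDn (1 : R) (-1) r; rewrite subrr expr0n => ->.
by apply: eq_bigr => j _; rewrite expr1n mul1r mulr_natr.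
Qed.

Lemma alternating_bin_wide r n : (r <= n)%N ->
  \sum_(j < n.+1) (-1) ^+ j * 'C(r, j)%:R = (r == 0)%:R :> R.
Proof.
move=> rn; rewrite -alternating_bin -!(big_mkord xpredT (fun j => (-1) ^+ j * 'C(r, j)%:R : R)).
rewrite (@big_cat_nat _ _ _ r.+1)//= [X in _ + X]big_nat_cond [X in _ + X]big1 ?addr0//.
by move=> j /andP[/andP[rj _] _]; rewrite bin_small ?mulr0.
Qed.

(** The alternating sum of the binomials C(r, j) vanishes unless r = 0; applied to the number r of
    missing types, it combines the eigenfunction identities into the indicator of a complete
    collection. *)
Lemma fullE N k : (0 < N)%N ->
  full N k = \sum_(j < N.+1) (-1) ^+ j * 'C(N, j)%:R * (1 - j%:R / N%:R) ^+ k.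
Proof.
move=> N0.
under eq_bigr do rewrite -mulrA -sum_occ_bin// mulr_sumr.
rewrite exchange_big /= big_ord_recr /= subnn big1 ?add0r => [|i _].
  under eq_bigr do rewrite mulrCA.
  by rewrite -mulr_sumr alternating_bin_wide// mulr1.
under eq_bigr do rewrite mulrCA.
rewrite -mulr_sumr alternating_bin_wide ?leq_subr//.
by rewrite subn_eq0 leqNgt ltn_ord mulr0.
Qed.

Lemma full_ge0 N k : 0 <= full N k.
Proof. exact: occ_ge0. Qed.

Lemma full_le1 N k : (0 < N)%N -> full N k <= 1.
Proof. by move=> N0; exact: occ_le1. Qed.

Lemma one_sub_full N k : (0 < N)%N -> 1 - full N k = \sum_(i < N) occ N k i.
Proof. by move=> N0; rewrite -(occ_sum k N0) big_ord_recr/= addrK. Qed.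

(** Markov's inequality for the number of missing types, whose mean is the case j = 1 of
    [sum_occ_bin]. *)
Lemma one_sub_full_le N k : (0 < N)%N ->
  1 - full N k <= N%:R * (1 - N%:R^-1) ^+ k.
Proof.
move=> N0; have := sum_occ_bin k 1 N0; rewrite bin1 mul1r => <-.
rewrite one_sub_full// big_ord_recr/= subnn mulr0 addr0.
apply: ler_sum => i _; rewrite bin1 ler_peMr ?occ_ge0//.
by rewrite ler1n subn_gt0.
Qed.

Lemma fullS N k : (0 < N)%N -> full N k.+1 = full N k + N%:R^-1 * occ N k N.-1.
Proof.
case: N => // N _; rewrite /full /=.
by rewrite subSnn divff ?mul1r// pnatr_eq0.
Qed.

Lemma full_homo N : (0 < N)%N -> {homo full N : k l / (k <= l)%N >-> k <= l}.
Proof.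
move=> N0; apply: homo_leq => [//||i]; first exact: le_trans.
by rewrite fullS// lerDl mulr_ge0 ?occ_ge0// invr_ge0.
Qed.

Lemma full_lipschitz N k l : (0 < N)%N -> full N (k + l) - full N k <= l%:R / N%:R.
Proof.
move=> N0; elim: l => [|l IHl]; first by rewrite addn0 subrr mul0r.
rewrite addnS fullS// -natr1 mulrDl mul1r addrAC lerD//.
by rewrite ler_piMr ?invr_ge0// occ_le1// leq_pred.
Qed.

Lemma full_diff2 N k : (0 < N)%N ->
  `|(full N k.+2 - full N k.+1) - (full N k.+1 - full N k)| <= 2 / N%:R ^+ 2.
Proof.
move=> N0; have NR : 0 < N%:R :> R by rewrite ltr0n.
have -> : full N k.+2 - full N k.+1 - (full N k.+1 - full N k) =
    N%:R^-1 * (occ N k.+1 N.-1 - occ N k N.-1).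
  by rewrite (fullS k.+1 N0) (fullS k N0); ring.
rewrite normrM gtr0_norm ?invr_gt0// expr2 invfM mulrCA ler_pM2l ?invr_gt0//.
(* State N - 1 is left with probability 1 / N and entered from N - 2 with probability 2 / N, which
   gives the second factor 1 / N. For N = 1 there is no state to enter from. *)
have E : occ N k.+1 N.-1 - occ N k N.-1 = N%:R^-1 *
   ((if N.-1 is i.+1 then 2 * occ N k i else 0) - occ N k N.-1).
  case: N N0 NR => [//|[|N]] _ NR /=; first by field.
  have -> : (N.+2 - N)%:R = 2 :> R by rewrite -[N.+2]addn2 addKn.
  have -> : N.+1%:R = N.+2%:R - 1 :> R by rewrite -[N.+2%:R]natr1 addrK.
  move: N.+2%:R NR => x x0; field; exact: lt0r_neq0.
rewrite E normrM gtr0_norm ?invr_gt0// mulrC ler_pM2r ?invr_gt0//.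
have := occ_ge0 N k N.-1; have := occ_le1 k (leq_pred N) N0.
case: N {NR E} N0 => [//|[|N]] _ /= a1 a0.
  by rewrite sub0r normrN ger0_norm//; lra.
have b0 := occ_ge0 N.+2 k N; have b1 : occ N.+2 k N <= 1.
  by apply: occ_le1 => //; exact/leqW/leqW.
by rewrite ler_norml; apply/andP; split; lra.
Qed.

Definition harm (i n : nat) : R := \sum_(k < n) k.+1%:R^-1 ^+ i.

(* Second moment of the time needed to complete the collection when [r] of the
   [N] types are missing; the corresponding mean is [N * harm 1 r]. *)
Definition mom2 N r : R := N%:R ^+ 2 * (harm 1 r ^+ 2 + harm 2 r) - N%:R * harm 1 r.

Lemma harm_ge0 i n : 0 <= harm i n.
Proof. by apply: sumr_ge0 => k _; rewrite exprn_ge0// invr_ge0. Qed.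

(** Dynkin's formula: with r types missing, [N * harm 1 r] drops by N / r with probability r / N,
    hence by 1 in the mean, until r = 0. The last sum is the expected time still needed after [K]
    draws. *)
Lemma mean_full N K : (0 < N)%N ->
  \sum_(k < K) (1 - full N k) =
  N%:R * harm 1 N - \sum_(i < N.+1) occ N K i * (N%:R * harm 1 (N - i)).
Proof.
move=> N0; have NR : N%:R != 0 :> R by rewrite pnatr_eq0 -lt0n.
elim: K => [|K IHK].
  rewrite big_ord0 big_ord_recl/= subn0 mul1r big1 ?addr0 ?subrr// => i _.
  by rewrite mul0r.
rewrite big_ord_recr/= {}IHK -addrA; congr (_ + _).
rewrite (occ_step K (fun i => N%:R * harm 1 (N - i)))// one_sub_full//.
rewrite ![\sum_(i < N.+1) _]big_ord_recr/= !subnn /harm !big_ord0.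
rewrite !(mulr0, mul0r, addr0).
apply/eqP; rewrite addrC -subr_eq0 opprK addrAC; apply/eqP.
rewrite -sumrN -!big_split big1//= => i _.
case: i => i /= iN; have iN' := ltnW iN.
have -> : (N - i = (N - i.+1).+1)%N by rewrite subnSK.
rewrite big_ord_recr/= expr1.
have -> : i%:R = N%:R - (N - i.+1).+1%:R :> R by rewrite subnSK// natrB// opprB addrC subrK.
have : (N - i.+1).+1%:R != 0 :> R by rewrite pnatr_eq0.
by move: (N - i.+1).+1%:R N%:R NR => x y y0 x0; field; rewrite ?x0 ?y0.
Qed.

(** For the completion time T the left side is the mean of min(T, K)^2. When T > K, the time t still
    needed adds (K + t)^2 - K^2 = 2 K t + t^2, whence the two terms of the remainder. *)
Lemma mom2_full N K : (0 < N)%N ->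
  \sum_(k < K) k.*2.+1%:R * (1 - full N k) =
  mom2 N N - \sum_(i < N.+1) occ N K i *
     (2 * K%:R * (N%:R * harm 1 (N - i)) + mom2 N (N - i)).
Proof.
move=> N0; have NR : N%:R != 0 :> R by rewrite pnatr_eq0 -lt0n.
elim: K => [|K IHK].
  rewrite big_ord0 big_ord_recl/= subn0 mul1r big1 ?addr0.
    by rewrite mulr0 mul0r add0r subrr.
  by move=> i _; rewrite mul0r.
rewrite big_ord_recr/= {}IHK -addrA; congr (_ + _).
rewrite (occ_step K (fun i => 2 * K.+1%:R * (N%:R * harm 1 (N - i)) + mom2 N (N - i)))// one_sub_full//.
rewrite ![\sum_(i < N.+1) _]big_ord_recr/= !subnn /mom2 /harm !big_ord0.
rewrite expr0n /= !(mulr0, mul0r, addr0, subr0).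
apply/eqP; rewrite addrC -subr_eq0 opprK addrAC; apply/eqP.
rewrite mulr_sumr -sumrN -!big_split big1//= => i _.
case: i => i /= iN; have iN' := ltnW iN.
have -> : (N - i = (N - i.+1).+1)%N by rewrite subnSK.
rewrite !big_ord_recr/=.
have -> : i%:R = N%:R - (N - i.+1).+1%:R :> R by rewrite subnSK// natrB// opprB addrC subrK.
have : (N - i.+1).+1%:R != 0 :> R by rewrite pnatr_eq0.
rewrite -muln2 -(natr1 (K * 2)) -(natr1 K) natrM.
by move: (N - i.+1).+1%:R N%:R NR => x y y0 x0; field; rewrite ?x0 ?y0.
Qed.

Lemma mean_full_bounds N K : (0 < N)%N ->
  N%:R * harm 1 N * full N K <= \sum_(k < K) (1 - full N k) <= N%:R * harm 1 N.
Proof.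
Abort.
End Occupancy.

(** * Bounds for the truncated moments *)

Section MomentBounds.
Variable R : realFieldType.
Implicit Types (N k i j r : nat).

Lemma le_harm i : {homo @harm R i : m n / (m <= n)%N >-> m <= n}.
Proof.
apply: homo_leq => [//||n]; first exact: le_trans.
by rewrite /harm big_ord_recr/= lerDl exprn_ge0// invr_ge0.
Qed.

Lemma harm1_ge1 n : (0 < n)%N -> 1 <= harm R 1 n.
Proof.
by move=> n0; apply: le_trans (le_harm 1 n0); rewrite /harm big_ord1 invr1 expr1n.
Qed.

Lemma mom2_ge0 N r : (0 < N)%N -> 0 <= mom2 R N r.
Proof.
move=> N0; case: r => [|r]; first by rewrite /mom2 /harm !big_ord0 expr0n/= !mulr0 addr0 mulr0 subr0.
have h1 : 1 <= harm R 1 r.+1 by exact: harm1_ge1.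
have h2 := harm_ge0 R 2 r.+1.
have N1 : 1 <= N%:R :> R by rewrite ler1n.
rewrite /mom2; move: (harm R 1 _) (harm R 2 _) N%:R h1 h2 N1 => a b x a1 b0 x1.
have -> : x ^+ 2 * (a ^+ 2 + b) - x * a = (x * a) * (x * a - 1) + x ^+ 2 * b by ring.
have xa := mulr_ege1 x1 a1.
by rewrite addr_ge0 ?mulr_ge0 ?subr_ge0// ?exprn_ge0//; lra.
Qed.

Lemma mom2_le N r : (0 < N)%N -> (r <= N)%N ->
  mom2 R N r <= N%:R ^+ 2 * (harm R 1 N ^+ 2 + harm R 2 N).
Proof.
move=> N0 rN; rewrite /mom2 lerBlDr ler_wpDr ?mulr_ge0 ?harm_ge0//.
rewrite ler_wpM2l ?exprn_ge0// lerD ?le_harm//.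
by rewrite lerXn2r ?le_harm// nnegrE harm_ge0.
Qed.

Lemma sum_occ_le N K (g : nat -> R) B : (0 < N)%N -> g 0%N = 0 ->
  (forall r, (r <= N)%N -> g r <= B) ->
  \sum_(i < N.+1) occ R N K i * g (N - i)%N <= B * (1 - full R N K).
Proof.
move=> N0 g0 gB; rewrite big_ord_recr/= subnn g0 mulr0 addr0.
rewrite one_sub_full// mulr_sumr; apply: ler_sum => i _.
by rewrite mulrC ler_wpM2r ?occ_ge0// gB// leq_subr.
Qed.

Lemma mean_full_bounds N K : (0 < N)%N ->
  N%:R * harm R 1 N - N%:R * harm R 1 N * (1 - full R N K) <=
  \sum_(k < K) (1 - full R N k) <= N%:R * harm R 1 N.
Proof.
move=> N0; rewrite mean_full//; apply/andP; split; last first.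
  rewrite gerBl sumr_ge0// => i _.
  by rewrite mulr_ge0 ?occ_ge0// mulr_ge0 ?harm_ge0.
rewrite lerD2l lerN2.
apply: (@sum_occ_le N K (fun r => N%:R * harm R 1 r)) => //.
  by rewrite /harm big_ord0 mulr0.
by move=> r rN; rewrite ler_wpM2l ?le_harm.
Qed.

Lemma mom2_full_bounds N K : (0 < N)%N ->
  mom2 R N N -
    (2 * K%:R * (N%:R * harm R 1 N) + N%:R ^+ 2 * (harm R 1 N ^+ 2 + harm R 2 N))
      * (1 - full R N K) <=
  \sum_(k < K) k.*2.+1%:R * (1 - full R N k) <= mom2 R N N.
Proof.
move=> N0; rewrite mom2_full//; apply/andP; split; last first.
  rewrite gerBl sumr_ge0// => i _.
  by rewrite mulr_ge0 ?occ_ge0// addr_ge0 ?mom2_ge0// !mulr_ge0 ?harm_ge0.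
rewrite lerD2l lerN2.
apply: (@sum_occ_le N K (fun r => 2 * K%:R * (N%:R * harm R 1 r) + mom2 R N r)) => //.
  by rewrite /mom2 /harm !big_ord0 expr0n/= !(mulr0, addr0, subr0).
move=> r rN; rewrite lerD ?mom2_le// ler_wpM2l ?mulr_ge0// ler_wpM2l//.
exact: le_harm.
Qed.

End MomentBounds.

(** * Binomial smoothing of functions with small second differences *)

Section BinomialSmoothing.
Variable R : realFieldType.
Implicit Types (f g : nat -> R) (c q : R) (k m l L : nat).

(** Summing the second differences gives c l (l - 1) / 2 at distance l to the right of [k] and c l
    (l + 1) / 2 to the left; both are at most c l^2. *)
Lemma taylor2 f c :
  (forall k, `|(f k.+2 - f k.+1) - (f k.+1 - f k)| <= c) ->
  forall k m, `|f m - f k - (m%:R - k%:R) * (f k.+1 - f k)| <= c * (m%:R - k%:R) ^+ 2.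
Proof.
move=> fc; have c0 : 0 <= c by apply: le_trans (fc 0%N).
have slope k l : `|(f (k + l).+1 - f (k + l)%N) - (f k.+1 - f k)| <= c * l%:R.
  elim: l => [|l IHl]; first by rewrite addn0 subrr normr0 mulr0.
  have -> : (f (k + l.+1).+1 - f (k + l.+1)%N) - (f k.+1 - f k) =
      ((f (k + l).+1 - f (k + l)%N) - (f k.+1 - f k)) +
      ((f (k + l).+2 - f (k + l).+1) - (f (k + l).+1 - f (k + l)%N)).
    by rewrite addnS; ring.
  apply: le_trans (ler_normD _ _) _.
  by rewrite -natr1 mulrDr mulr1 lerD.
have lin l : 0 <= c * l%:R by rewrite mulr_ge0.
move=> k m; have [km|/ltnW mk] := leqP k m.
  rewrite -(subnKC km) natrD [X in X - k%:R]addrC addrK.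
  elim: (m - k)%N => [|l IHl].
    by rewrite addn0 subrr mul0r subrr normr0 expr0n/= mulr0.
  have -> : f (k + l.+1)%N - f k - l.+1%:R * (f k.+1 - f k) =
      (f (k + l)%N - f k - l%:R * (f k.+1 - f k)) +
      ((f (k + l).+1 - f (k + l)%N) - (f k.+1 - f k)).
    by rewrite addnS -natr1; ring.
  apply: le_trans (ler_normD _ _) _.
  apply: le_trans (lerD IHl (slope k l)) _.
  rewrite -natr1; have := lin l; move: l%:R => x; nra.
rewrite -(subnKC mk) natrD opprD addrA subrr add0r sqrrN.
elim: (k - m)%N => [|l IHl].
  by rewrite addn0 oppr0 mul0r !subr0 subrr normr0 expr0n/= mulr0.
have -> : f m - f (m + l.+1)%N - - l.+1%:R * (f (m + l.+1).+1 - f (m + l.+1)%N) =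
    (f m - f (m + l)%N - - l%:R * (f (m + l).+1 - f (m + l)%N)) +
    l.+1%:R * ((f (m + l).+2 - f (m + l).+1) - (f (m + l).+1 - f (m + l)%N)).
  by rewrite addnS -natr1; ring.
apply: le_trans (ler_normD _ _) _.
rewrite normrM ger0_norm//.
apply: le_trans (lerD IHl (ler_wpM2l _ (fc _))) _ => //.
rewrite -natr1; have := lin l; move: l%:R => x; nra.
Qed.

(* Expectation of [f] at a binomial variable of parameters [L] and [q]. *)
Fixpoint bexp q L f : R :=
  if L is L'.+1 then (1 - q) * bexp q L' f + q * bexp q L' (f \o S) else f 0%N.

Lemma eq_bexp q L f g : f =1 g -> bexp q L f = bexp q L g.
Proof.
elim: L f g => [|L IHL] f g fg /=; first exact: fg.
by congr (_ * _ + _ * _); apply: IHL => m //=; exact: fg.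
Qed.

Lemma ler_norm_bexp q L f g : 0 <= q <= 1 -> (forall m, `|f m| <= g m) ->
  `|bexp q L f| <= bexp q L g.
Proof.
move=> /andP[q0 q1]; elim: L f g => [|L IHL] f g fg /=; first exact: fg.
apply: le_trans (ler_normD _ _) _; rewrite !normrM (ger0_norm q0).
have q1' : 0 <= 1 - q by rewrite subr_ge0.
by rewrite (ger0_norm q1') lerD// ler_wpM2l// IHL// => m; exact: fg.
Qed.

Lemma bexp_affine q L f (a b s : R) :
  bexp q L (fun m => f m - a - (m%:R - b) * s) = bexp q L f - a - (L%:R * q - b) * s.
Proof.
elim: L f b => [|L IHL] f b /=; first by rewrite mul0r.
rewrite IHL [X in q * X](@eq_bexp q L _ (fun m => (f \o S) m - a - (m%:R - (b - 1)) * s)).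
  by rewrite IHL -natr1; ring.
by move=> m /=; rewrite -natr1; ring.
Qed.

Lemma bexp_sqr q L (c b : R) :
  bexp q L (fun m => c * (m%:R - b) ^+ 2) =
  c * ((L%:R * q - b) ^+ 2 + L%:R * q * (1 - q)).
Proof.
elim: L b => [|L IHL] b /=; first by rewrite !mul0r addr0.
rewrite IHL (@eq_bexp q L _ (fun m => c * (m%:R - (b - 1)) ^+ 2)).
  by rewrite IHL -natr1; ring.
by move=> m /=; rewrite -natr1; ring.
Qed.

Lemma bexp_sum q L n (a x : nat -> R) :
  bexp q L (fun m => \sum_(j < n) a j * x j ^+ m) =
  \sum_(j < n) a j * (1 - q + q * x j) ^+ L.
Proof.
elim: L a => [|L IHL] a /=; first by apply: eq_bigr.
rewrite IHL (@eq_bexp q L _ (fun m => \sum_(j < n) (a j * x j) * x j ^+ m)).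
  rewrite (IHL (fun j => a j * x j)) !mulr_sumr -big_split/=; apply: eq_bigr => j _.
  by rewrite exprS; ring.
by move=> m /=; apply: eq_bigr => j _; rewrite exprS mulrA.
Qed.

(** The binomial variable has mean [k], so the linear term of the expansion at [k] averages to 0;
    the quadratic one gives the variance k (1 - q). *)
Lemma bexp_approx f c q L k : 0 <= q <= 1 -> L%:R * q = k%:R ->
  (forall k, `|(f k.+2 - f k.+1) - (f k.+1 - f k)| <= c) ->
  `|bexp q L f - f k| <= c * k%:R.
Proof.
move=> q01 Lq fc; have c0 : 0 <= c by apply: le_trans (fc 0%N).
have -> : bexp q L f - f k =
    bexp q L (fun m => f m - f k - (m%:R - k%:R) * (f k.+1 - f k)).
  by rewrite bexp_affine Lq subrr mul0r subr0.
apply: le_trans (@ler_norm_bexp q L _ _ q01 (taylor2 fc k)) _.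
rewrite bexp_sqr Lq subrr expr0n add0r ler_wpM2l// ler_piMr//.
by rewrite gerBl; case/andP: q01.
Qed.

(** With q = k / L the mean is [k] for every [L], and smoothing turns the geometric term (1 - j /
    N)^m of [fullE] into (1 - q j / N)^L. The error does not depend on [L], which leaves [L] free to
    tend to infinity. *)
Lemma full_binomial N k L : (0 < N)%N -> (0 < L)%N -> (k <= L)%N ->
  `|\sum_(j < N.+1) (-1) ^+ j * 'C(N, j)%:R * (1 - (k%:R * j%:R / N%:R) / L%:R) ^+ L
    - full R N k| <= 2 / N%:R ^+ 2 * k%:R.
Proof.
move=> N0 L0 kL.
have NR : N%:R != 0 :> R by rewrite pnatr_eq0 -lt0n.
have LR : L%:R != 0 :> R by rewrite pnatr_eq0 -lt0n.
have -> : \sum_(j < N.+1) (-1) ^+ j * 'C(N, j)%:R *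
    (1 - (k%:R * j%:R / N%:R) / L%:R) ^+ L = bexp (k%:R / L%:R) L (full R N).
  rewrite (@eq_bexp _ _ _ _ (fun m => fullE R m N0)).
  rewrite (bexp_sum _ _ N.+1 (fun j => (-1) ^+ j * 'C(N, j)%:R) (fun j => 1 - j%:R / N%:R)).
  by apply: eq_bigr => j _; congr (_ * _ ^+ _); field; rewrite NR LR.
apply: bexp_approx => [||m]; last exact: full_diff2.
- by rewrite divr_ge0//= ler_pdivrMr ?ltr0n// mul1r ler_nat.
- by rewrite mulrCA divff// mulr1.
Qed.
End BinomialSmoothing.

(** * Exponential approximation and scaling *)

Section ExponentialApproximation.
Variable R : realType.
Implicit Types (N k j m n X : nat) (x y : R).

Lemma bernoulli_ineq (u : R) L : 0 <= u <= 1 -> 1 - L%:R * u <= (1 - u) ^+ L.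
Proof.
move=> /andP[u0 u1]; elim: L => [|L IHL]; first by rewrite mul0r subr0.
rewrite exprS -natr1.
have : (1 - u) * (1 - L%:R * u) <= (1 - u) * (1 - u) ^+ L by rewrite ler_wpM2l// subr_ge0.
have : 0 <= L%:R * u * u by rewrite !mulr_ge0.
lra.
Qed.

(** For the lower bound put y = x / L: since 1 + y <= exp y, exp(-y) (1 - y^2) <= 1 - y. Raise this
    to the power [L] and apply Bernoulli's inequality to (1 - y^2)^L. *)
Lemma exp_sandwich x L : 0 <= x -> (0 < L)%N -> x <= L%:R ->
  expR (- x) * (1 - x ^+ 2 / L%:R) <= (1 - x / L%:R) ^+ L <= expR (- x).
Proof.
move=> x0 L0 xL; have LR : 0 < L%:R :> R by rewrite ltr0n.
have LR0 := lt0r_neq0 LR.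
set y := x / L%:R.
have y0 : 0 <= y by rewrite divr_ge0.
have y1 : y <= 1 by rewrite ler_pdivrMr// mul1r.
have E : expR (- x) = expR (- y) ^+ L by rewrite -expRM_natl mulrN mulrC divfK.
apply/andP; split; last first.
  by rewrite E lerXn2r ?nnegrE ?subr_ge0 ?expR_ge0//; exact: expR_ge1Dx.
apply: (@le_trans _ _ (expR (- x) * (1 - y ^+ 2) ^+ L)).
  rewrite ler_wpM2l ?expR_ge0//.
  have -> : x ^+ 2 / L%:R = L%:R * y ^+ 2 by rewrite /y; field.
  by apply: bernoulli_ineq; rewrite exprn_ge0//= exprn_ile1.
rewrite E -exprMn.
have h : expR (- y) * (1 - y ^+ 2) <= 1 - y.
  rewrite expRN -ler_pdivlMl ?invr_gt0 ?expR_gt0// invrK.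
  have -> : 1 - y ^+ 2 = (1 + y) * (1 - y) by ring.
  by rewrite ler_wpM2r ?subr_ge0// expR_ge1Dx.
by rewrite lerXn2r ?nnegrE ?subr_ge0// mulr_ge0 ?expR_ge0// subr_ge0 exprn_ile1.
Qed.

Lemma cvg_1BxV x : 0 <= x -> (1 - x / L%:R) ^+ L @[L --> \oo] --> expR (- x).
Proof.
move=> x0.
apply: (@squeeze_cvgr _ _ _ _ (fun L => expR (- x) * (1 - x ^+ 2 / L%:R)) (fun=> expR (- x))).
- near=> L; apply: exp_sandwich => //; first by near: L; exact: nbhs_infty_gt.
  by near: L; exact: nbhs_infty_ger.
- rewrite -[X in _ --> X]mulr1; apply: cvgMr; rewrite -[X in _ --> X]subr0.
  apply: cvgB; first exact: cvg_cst.
  rewrite -(mulr0 (x ^+ 2)); apply: cvgMr.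
  by rewrite -(cvg_shiftS (fun L : nat => L%:R^-1 : R)); exact: cvg_harmonic.
- exact: cvg_cst.
Unshelve. all: by end_near. Qed.

Lemma full_exp N k : (0 < N)%N ->
  `|(1 - expR (- (k%:R / N%:R))) ^+ N - full R N k| <= 2 / N%:R ^+ 2 * k%:R.
Proof.
move=> N0.
have -> : (1 - expR (- (k%:R / N%:R))) ^+ N =
    \sum_(j < N.+1) (-1) ^+ j * 'C(N, j)%:R * expR (- (k%:R * j%:R / N%:R : R)).
  rewrite exprDn; apply: eq_bigr => j _.
  rewrite expr1n mul1r (exprNn (expR _)) -mulr_natr mulrAC -expRM_natl; congr (_ * _ * expR _).
  by ring.
apply: (@ler_cvg_to _ \oo _ R (fun L : nat => `|\sum_(j < N.+1) (-1) ^+ j * 'C(N, j)%:R *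
   (1 - (k%:R * j%:R / N%:R) / L%:R) ^+ L - full R N k|) (fun=> 2 / N%:R ^+ 2 * k%:R)).
- apply: cvg_norm; apply: cvgB; last exact: cvg_cst.
  apply: cvg_big => [|j _]; first by move=> ?; exact: add_continuous.
  by apply: cvgMr; apply: cvg_1BxV; rewrite divr_ge0// mulr_ge0.
- exact: cvg_cst.
- near=> L; apply: full_binomial => //; near: L; [exact: nbhs_infty_gt|exact: nbhs_infty_ge].
Unshelve. all: by end_near. Qed.

Lemma one_sub_full_exp N k : (0 < N)%N -> 1 - full R N k <= N%:R * expR (- (k%:R / N%:R)).
Proof.
move=> N0; apply: le_trans (one_sub_full_le R k N0) _; rewrite ler_wpM2l//.
have -> : - (k%:R / N%:R) = k%:R * - N%:R^-1 :> R by rewrite mulrN.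
rewrite expRM_natl lerXn2r ?nnegrE ?expR_ge0//; last exact: expR_ge1Dx.
by rewrite subr_ge0 invf_le1 ?ler1n ?ltr0n.
Qed.

Lemma ler_norm_subX x y j : 0 <= x <= 1 -> 0 <= y <= 1 ->
  `|x ^+ j - y ^+ j| <= j%:R * `|x - y|.
Proof.
move=> /andP[x0 x1] /andP[y0 y1]; elim: j => [|j IHj]; first by rewrite subrr normr0 mul0r.
have -> : x ^+ j.+1 - y ^+ j.+1 = x ^+ j * (x - y) + y * (x ^+ j - y ^+ j).
  by rewrite !exprS; ring.
apply: le_trans (ler_normD _ _) _; rewrite !normrM -natr1 mulrDl mul1r addrC lerD//.
  by apply: le_trans IHj; rewrite ler_piMl// ger0_norm.
by rewrite ler_piMl// normrX ger0_norm// exprn_ile1.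
Qed.

(* [(1 - exp (- k / N)) ^ N], raised to the power [j], is the same expression
   for [j * N] types and time [j * k]. *)
Lemma scaling_near N j m : (0 < N)%N -> (0 < j)%N ->
  `|full R (j * N) m - full R N (m %/ j) ^+ j| <= N%:R^-1 + 4 * m%:R / N%:R ^+ 2.
Proof.
move=> N0 j0; have jN0 : (0 < j * N)%N by rewrite muln_gt0 j0.
have NR : 0 < N%:R :> R by rewrite ltr0n.
have jR : 1 <= j%:R :> R by rewrite ler1n.
have jR0 : j%:R != 0 :> R by rewrite pnatr_eq0 -lt0n.
set k := (m %/ j)%N; set G := (1 - expR (- (k%:R / N%:R : R))) ^+ N.
have G01 : 0 <= G <= 1.
  have e0 : 0 <= k%:R / N%:R :> R by rewrite divr_ge0.
  have := expR_gt0 (- (k%:R / N%:R : R)); have : expR (- (k%:R / N%:R : R)) <= 1.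
    by rewrite expR_le1 oppr_le0.
  by move=> e1 e2; rewrite exprn_ge0 ?exprn_ile1//; lra.
have km : j%:R * k%:R <= m%:R :> R by rewrite -natrM mulnC ler_nat leq_trunc_div.
have k0 : 0 <= k%:R :> R by [].
(* Rounding [m] down to a multiple of [j] skips fewer than [j] times, with increments of at most 1 /
   (j N). *)
have e1 : `|full R (j * N) m - full R (j * N) (k * j)| <= N%:R^-1.
  rewrite {1}(divn_eq m j) -/k ger0_norm ?subr_ge0 ?full_homo ?leq_addr//.
  apply: le_trans (full_lipschitz R _ _ jN0) _.
  rewrite natrM invfM mulrA ler_piMl ?invr_ge0//.
  by rewrite ler_pdivrMr ?mul1r ?ler_nat ?ltr0n// ltnW// ltn_pmod.
have e2 : `|G ^+ j - full R (j * N) (k * j)| <= 2 / N%:R ^+ 2 * m%:R.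
  have := full_exp (k * j) jN0.
  have -> : (k * j)%:R / (j * N)%:R = k%:R / N%:R :> R.
    by rewrite !natrM; field; rewrite jR0 lt0r_neq0.
  rewrite -exprM (mulnC N j) => h; apply: (le_trans h).
  apply: ler_pM; rewrite ?divr_ge0 ?exprn_ge0 ?ler_nat ?leq_trunc_div//.
  rewrite ler_pM2l// lef_pV2 ?posrE ?exprn_gt0 ?ltr0n//.
  by apply: lerXn2r; rewrite ?nnegrE// ler_nat leq_pmull.
(* The factor [j] lost by taking powers is absorbed by j k <= m. *)
have e3 : `|G ^+ j - full R N k ^+ j| <= 2 / N%:R ^+ 2 * m%:R.
  apply: le_trans (ler_norm_subX _ G01 _) _; first by rewrite full_ge0 full_le1.
  apply: le_trans (ler_wpM2l _ (full_exp k N0)) _ => //.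
  by rewrite mulrCA ler_wpM2l// divr_ge0// exprn_ge0.
have -> : full R (j * N) m - full R N k ^+ j = (full R (j * N) m - full R (j * N) (k * j))
   + ((G ^+ j - full R N k ^+ j) - (G ^+ j - full R (j * N) (k * j))) by ring.
apply: le_trans (ler_normD _ _) _; rewrite lerD//.
apply: le_trans (ler_normB _ _) _; apply: le_trans (lerD e3 e2) _.
by rewrite le_eqVlt; apply/orP; left; apply/eqP; ring.
Qed.

Lemma one_sub_exprn_le x j : 0 <= x <= 1 -> 1 - x ^+ j <= j%:R * (1 - x).
Proof.
move=> x01; have := @ler_norm_subX 1 x j; rewrite ler01 lexx expr1n => /(_ isT x01).
case/andP: x01 => x0 x1; rewrite (@ger0_norm _ (1 - x)) ?subr_ge0//.
exact/le_trans/ler_norm.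
Qed.

(** Both terms lie between 1 - B and 1, with B the right-hand side. The factor [expR 1] pays for the
    rounding: [k] = [m %/ j] satisfies k / N >= m / (j N) - 1 / N. *)
Lemma scaling_far N j m : (0 < N)%N -> (0 < j)%N ->
  `|full R (j * N) m - full R N (m %/ j) ^+ j| <=
  expR 1 * ((j * N)%:R * expR (- (m%:R / (j * N)%:R))).
Proof.
move=> N0 j0; have jN0 : (0 < j * N)%N by rewrite muln_gt0 j0.
have NR : 0 < N%:R :> R by rewrite ltr0n.
have jR : 0 < j%:R :> R by rewrite ltr0n.
set k := (m %/ j)%N; set B := expR 1 * _.
have Fk : 0 <= full R N k <= 1 by rewrite full_ge0 full_le1.
have h1 : 1 - full R (j * N) m <= B.
  apply: le_trans (one_sub_full_exp m jN0) _.
  rewrite ler_peMl// ?mulr_ge0 ?expR_ge0//.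
  by apply: le_trans (expR_ge1Dx _); rewrite lerDl.
have h2 : 1 - full R N k ^+ j <= B.
  apply: le_trans (one_sub_exprn_le _ Fk) _.
  apply: le_trans (ler_wpM2l _ (one_sub_full_exp k N0)) _ => //.
  rewrite mulrA -natrM /B mulrCA ler_wpM2l// -expRD ler_expR natrM invfM mulrA.
  rewrite -mulNr -ler_pdivlMr ?invr_gt0// invrK mulrDl mulNr divfK ?lt0r_neq0//.
  rewrite mul1r.
  have : m%:R / j%:R <= k%:R + 1 :> R.
    by rewrite ler_pdivrMr// natr1 -natrM ler_nat ltnW// ltn_ceil.
  have : 1 <= N%:R :> R by rewrite ler1n.
  lra.
have : 0 <= full R N k ^+ j <= 1 by case/andP: Fk => *; rewrite exprn_ge0//= exprn_ile1.
have := full_ge0 R (j * N) m; have := full_le1 R m jN0.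
by move=> a1 a0 /andP[b0 b1]; rewrite ler_norml; apply/andP; split; lra.
Qed.

Lemma expRN_le_cube y : 0 < y -> expR (- y) <= 6 / y ^+ 3.
Proof.
move=> y0; rewrite expRN -[6]invrK -invfM lef_pV2 ?posrE ?expR_gt0//; last first.
  by rewrite mulr_gt0 ?invr_gt0 ?exprn_gt0.
have := @expR_ge1Dxn R y 2 (ltW y0); rewrite -[3`!]/6%N.
by rewrite [6^-1 * _]mulrC; apply: le_trans; rewrite lerDr.
Qed.

(** The exponential is split into two halves exp(-y) with y = m / (2n). As y >= 4 ln n, one half is
    at most 1 / n^4; the other is at most 6 / y^3 = 48 n^3 / m^3, and the powers of n cancel. *)
Lemma exp_tail n m : (0 < n)%N -> (0 < m)%N -> 8 * n%:R * ln (n%:R : R) <= m%:R ->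
  n%:R * expR (- (m%:R / n%:R)) <= 48 / m%:R ^+ 3 :> R.
Proof.
move=> n0 m0 nm; have nR : 0 < n%:R :> R by rewrite ltr0n.
have mR : 0 < m%:R :> R by rewrite ltr0n.
have n2 : 0 < 2 * n%:R :> R by rewrite mulr_gt0.
set y : R := m%:R / (2 * n%:R).
have y0 : 0 < y by rewrite divr_gt0.
have -> : - (m%:R / n%:R) = - y + - y :> R by rewrite /y; field; exact: lt0r_neq0.
rewrite expRD.
have h1 : expR (- y) <= n%:R ^- 4.
  rewrite expRN lef_pV2 ?posrE ?expR_gt0 ?exprn_gt0//.
  rewrite -[leLHS]lnK ?posrE ?exprn_gt0// ler_expR lnXn// -[ln _ *+ 4]mulr_natl.
  rewrite /y ler_pdivlMr//; apply: le_trans nm.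
  by rewrite le_eqVlt; apply/orP; left; apply/eqP; ring.
have h2 := expRN_le_cube y0.
apply: (@le_trans _ _ (n%:R * (n%:R ^- 4 * (6 / y ^+ 3)))).
  by rewrite ler_wpM2l// ler_pM ?expR_ge0.
rewrite le_eqVlt; apply/orP; left; apply/eqP; rewrite /y; field.
by rewrite !lt0r_neq0.
Qed.
End ExponentialApproximation.

(** * Summing the scaling error *)

Section ScalingSums.
Variable R : realType.
Implicit Types (N k j m n X : nat) (x y K W : R).

Lemma sum_le_count K X : 0 <= K -> \sum_(m < X) ((m%:R <= K :> R)%:R : R) <= K + 1.
Proof.
move=> K0; elim: X => [|X IHX]; first by rewrite big_ord0 addr_ge0.
rewrite big_ord_recr/=; case: (leP X%:R K) => XK; last by rewrite addr0.
rewrite lerD// (le_trans _ XK)//.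
apply: (@le_trans _ _ (\sum_(m < X) 1)); last by rewrite sumr_const card_ord.
by apply: ler_sum => i _; rewrite lern1 leq_b1.
Qed.

Lemma harmS i n : harm R i n.+1 = harm R i n + n.+1%:R^-1 ^+ i.
Proof. by rewrite /harm big_ord_recr. Qed.

Lemma harm2_tail m n : (0 < m)%N -> (m <= n)%N ->
  harm R 2 n - harm R 2 m <= m%:R^-1 - n%:R^-1.
Proof.
move=> m0 /subnKC <-; elim: (n - m)%N => [|d IHd]; first by rewrite addn0 !subrr.
rewrite addnS harmS.
have a0 : 0 < (m + d)%:R :> R by rewrite ltr0n addn_gt0 m0.
suff : (m + d).+1%:R^-1 ^+ 2 <= (m + d)%:R^-1 - (m + d).+1%:R^-1 :> R.
  move=> h; have -> : m%:R^-1 - (m + d).+1%:R^-1 =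
      (m%:R^-1 - (m + d)%:R^-1) + ((m + d)%:R^-1 - (m + d).+1%:R^-1) :> R.
    by rewrite addrA subrK.
  by rewrite addrAC lerD.
rewrite -natr1; move: (m + d)%:R a0 => a a0.
have -> : a^-1 - (a + 1)^-1 = a^-1 * (a + 1)^-1 by field; rewrite !lt0r_neq0//; lra.
rewrite expr2 ler_wpM2r ?invr_ge0//; first by lra.
by rewrite lef_pV2 ?posrE//; lra.
Qed.

Lemma harm2_le2 n : harm R 2 n <= 2.
Proof.
case: n => [|n]; first by rewrite /harm big_ord0.
have h1 : harm R 2 1 = 1 by rewrite /harm big_ord1 invr1 expr1n.
have := @harm2_tail 1 n.+1 isT isT; rewrite h1 invr1.
have : 0 <= n.+1%:R^-1 :> R by rewrite invr_ge0.
by move: n.+1%:R^-1 (harm R 2 n.+1) => *; lra.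
Qed.

(** At most K + 1 indices satisfy m <= K; they use [scaling_near]. For the others w m <= 3m, and
    [scaling_far] with [exp_tail] gives 3m e 48 / m^3 = 144 e / m^2. *)
Lemma sum_scaling_error N j (w : nat -> R) W X :
  (0 < N)%N -> (0 < j)%N ->
  let K := 8 * (j * N)%:R * ln ((j * N)%:R : R) in
  (forall m, 0 <= w m <= m.*2.+1%:R) -> (forall m, m%:R <= K -> w m <= W) ->
  \sum_(m < X) w m * `|full R (j * N) m - full R N (m %/ j) ^+ j| <=
  (K + 1) * (W * (N%:R^-1 + 4 * K / N%:R ^+ 2)) + 288 * expR 1.
Proof.
move=> N0 j0 K wm wW.
have jN0 : (0 < j * N)%N by rewrite muln_gt0 j0.
have K0 : 0 <= K by rewrite !mulr_ge0// ln_ge0// ler1n.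
have W0 : 0 <= W by apply: le_trans (wW 0%N K0); case/andP: (wm 0%N).
set B := W * _.
have B0 : 0 <= B.
  apply: mulr_ge0 => //; apply: addr_ge0; first by rewrite invr_ge0.
  by apply: divr_ge0; [exact: mulr_ge0|exact: exprn_ge0].
(* The inverse of 0 is 0, so the term m = 0 adds nothing to the sum of 1 / m^2, which is at most 2;
   this makes 144 into 288. *)
apply: (@le_trans _ _ (\sum_(m < X)
    ((m%:R <= K)%R%:R * B + 144 * expR 1 * m%:R^-1 ^+ 2))); last first.
  rewrite big_split/= -mulr_suml -mulr_sumr; apply: lerD.
    by rewrite ler_wpM2r// sum_le_count.
  have -> : 288 * expR 1 = 144 * expR 1 * 2 :> R by ring.
  rewrite ler_wpM2l ?mulr_ge0 ?expR_ge0//.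
  case: X => [|X]; first by rewrite big_ord0.
  by rewrite big_ord_recl/= invr0 expr0n add0r; exact: harm2_le2.
apply: ler_sum => i _; move: (nat_of_ord i) => m {i X}.
have [w0 w1] := andP (wm m).
case: (leP m%:R K) => mK.
  rewrite mul1r ler_wpDr ?mulr_ge0 ?expR_ge0 ?exprn_ge0 ?invr_ge0//.
  apply: ler_pM => //; first exact: wW.
  apply: le_trans (scaling_near R _ N0 j0) _.
  rewrite lerD2l ler_wpM2r ?invr_ge0 ?exprn_ge0//.
  by rewrite ler_wpM2l.
rewrite mul0r add0r.
have m0 : (0 < m)%N by rewrite -(ltr0n R); exact: le_lt_trans mK.
have mR : 0 < m%:R :> R by rewrite ltr0n.
apply: (@le_trans _ _ (3 * m%:R * (expR 1 * (48 / m%:R ^+ 3)))).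
  apply: ler_pM => //.
    apply: (le_trans w1); rewrite -muln2 -natr1 natrM.
    have : 1 <= m%:R :> R by rewrite ler1n.
    lra.
  apply: le_trans (scaling_far R _ N0 j0) _.
  by rewrite ler_wpM2l ?expR_ge0// exp_tail// ltW.
rewrite le_eqVlt; apply/orP; left; apply/eqP; field; exact: lt0r_neq0.
Qed.

Lemma sum_blocks (w : nat -> R) (u : nat -> R) j n : (0 < j)%N ->
  \sum_(k < n) (\sum_(r < j) w (k * j + r)%N) * u k =
  \sum_(m < n * j) w m * u (m %/ j)%N.
Proof.
move=> j0; elim: n => [|n IHn]; first by rewrite !big_ord0.
rewrite big_ord_recr/= {}IHn mulSn addnC big_split_ord/=; congr (_ + _).
rewrite mulr_suml; apply: eq_bigr => r _.
by rewrite divnMDl// divn_small// addn0.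
Qed.

Lemma sum_odd_block a j : \sum_(r < j) (a + r).*2.+1%:R = (a + j)%:R ^+ 2 - a%:R ^+ 2 :> R.
Proof.
elim: j => [|j IHj]; first by rewrite big_ord0 addn0 subrr.
rewrite big_ord_recr/= {}IHj -muln2 -natr1 natrM addnS -natr1.
by ring.
Qed.

(** A crude bound: it only has to vanish as k grows with n fixed, in order to remove the truncation
    of the moments. *)
Lemma tail_le n k a b : (0 < n)%N -> (0 < k)%N -> 0 <= a -> 0 <= b ->
  (a * k%:R + b) * (1 - full R n k) <= (a + b) * 6 * n%:R ^+ 4 / k%:R.
Proof.
move=> n0 k0 a0 b0; have nR : 0 < n%:R :> R by rewrite ltr0n.
have k1 : 1 <= k%:R :> R by rewrite ler1n.
have kR : 0 < k%:R :> R by rewrite ltr0n.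
set y : R := k%:R / n%:R.
have y0 : 0 < y by rewrite divr_gt0.
have h2 := expRN_le_cube y0.
apply: (@le_trans _ _ (((a + b) * k%:R) * (n%:R * (6 / y ^+ 3)))).
  apply: ler_pM.
  - by rewrite addr_ge0// mulr_ge0.
  - by rewrite subr_ge0 full_le1.
  - by rewrite mulrDl lerD2l ler_peMr.
  - by apply: le_trans (one_sub_full_exp R k n0) _; rewrite ler_wpM2l.
have -> : (a + b) * k%:R * (n%:R * (6 / y ^+ 3)) = (a + b) * 6 * n%:R ^+ 4 * (k%:R^-1 ^+ 2).
  by rewrite /y; field; rewrite !lt0r_neq0.
rewrite ler_wpM2l ?mulr_ge0 ?addr_ge0 ?exprn_ge0// expr2 ler_piMl ?invr_ge0//.
by rewrite invf_le1.
Qed.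

(** Common form of both moments: (w, v, s) is (1, 1, j) for the mean and (2m + 1, 2k + 1, j^2) for
    the second moment, and [A] is the exact moment for [j * N] types. [C] may depend on [N], since X
    tends to infinity first. *)
Lemma power_survival_sum N j (w v : nat -> R) s A E C : (0 < N)%N -> (0 < j)%N ->
  (forall m, 0 <= w m) ->
  (forall k, \sum_(r < j) w (k * j + r)%N = s * v k) ->
  (forall X, \sum_(m < X) w m * `|full R (j * N) m - full R N (m %/ j) ^+ j| <= E) ->
  (forall X, (0 < X)%N ->
     A - C / X%:R <= \sum_(m < X) w m * (1 - full R (j * N) m) <= A) -> 0 <= C ->
  forall X, (0 < X)%N ->
    `|s * (\sum_(k < X) v k * (1 - full R N k ^+ j)) - A| <= E + C / X%:R.
Proof.
move=> N0 j0 w0 wv wE wA C0 X X0.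
have -> : s * (\sum_(k < X) v k * (1 - full R N k ^+ j)) =
    \sum_(m < X * j) w m * (1 - full R N (m %/ j) ^+ j).
  rewrite -(sum_blocks w (fun k => 1 - full R N k ^+ j))// mulr_sumr.
  by apply: eq_bigr => k _; rewrite wv mulrA.
have Xj0 : (0 < X * j)%N by rewrite muln_gt0 X0.
have -> : \sum_(m < X * j) w m * (1 - full R N (m %/ j) ^+ j) - A =
    (\sum_(m < X * j) w m * (full R (j * N) m - full R N (m %/ j) ^+ j)) +
    (\sum_(m < X * j) w m * (1 - full R (j * N) m) - A).
  rewrite addrA -big_split/=; congr (_ - _); apply: eq_bigr => m _.
  by move: (full R N _ ^+ j) (full R _ m) (w m) => x y z; ring.
apply: le_trans (ler_normD _ _) _; apply: lerD.
  apply: le_trans (wE (X * j)%N); apply: le_trans (ler_norm_sum _ _ _) _.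
  by apply: ler_sum => m _; rewrite normrM ger0_norm.
have /andP[a1 a2] := wA _ Xj0.
have : C / (X * j)%:R <= C / X%:R.
  by rewrite ler_wpM2l// lef_pV2 ?posrE ?ltr0n// ler_nat leq_pmulr.
by rewrite ler_norml => h; apply/andP; split; lra.
Qed.

(** The binomial expansion minus the alternating sum of binomials, which is 0 except for p = 0; this
    replaces each -x^j by 1 - x^j and makes every term summable over time. *)
Lemma survival_expand p x : (1 - x) ^+ p =
  \sum_(j < p) (-1) ^+ j * 'C(p, j.+1)%:R * (1 - x ^+ j.+1) + (p == 0)%:R.
Proof.
rewrite -(alternating_bin R p) exprDn !big_ord_recl/= !expr0 !bin0 expr1n !mulr1 mulr1n.
rewrite addrCA; congr (_ + _); rewrite -big_split/=; apply: eq_bigr => i _.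
rewrite /bump/= !add1n expr1n mul1r (exprNn x) -mulr_natr (exprS (-1) i).
by move: ((-1) ^+ i) (x ^+ i.+1) => a b; ring.
Qed.
End ScalingSums.

(** * Harmonic numbers *)

Section HarmonicAsymptotics.
Variable R : realType.
Implicit Types (n k m : nat) (x y : R).

Lemma ln_sub_le x y : 0 < x -> 0 < y -> ln x - ln y <= (x - y) / y.
Proof.
move=> x0 y0; have y_neq0 := lt0r_neq0 y0.
rewrite -ln_div ?posrE//.
have -> : x / y = 1 + (x - y) / y by field.
apply: le_ln1Dx; rewrite -subr_gt0 opprK.
have -> : (x - y) / y + 1 = x / y by field.
exact: divr_gt0.
Qed.

Definition log_gap n : R := harm R 1 n - ln n%:R.

Lemma log_gapS n : (0 < n)%N ->
  n.+1%:R^-1 - n%:R^-1 <= log_gap n.+1 - log_gap n <= 0.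
Proof.
move=> n0; have nR : 0 < n%:R :> R by rewrite ltr0n.
have n1 : 0 < n.+1%:R :> R by rewrite ltr0n.
have := ln_sub_le nR n1; have := ln_sub_le n1 nR.
rewrite /log_gap harmS expr1.
have -> : (n.+1%:R - n%:R) / n%:R = n%:R^-1 :> R by rewrite -natr1 addrAC subrr add0r mul1r.
have -> : (n%:R - n.+1%:R) / n.+1%:R = - n.+1%:R^-1 :> R.
  by rewrite -[n.+1%:R in X in X / _]natr1 opprD addrA subrr add0r mulN1r.
by move: (ln _) (ln _) (_^-1) (_^-1) (harm _ _ _) => a b c d e *; lra.
Qed.

Lemma log_gap_nonincr n m : (0 < n)%N -> (n <= m)%N -> log_gap m <= log_gap n.
Proof.
move=> n0 /subnKC <-; elim: (m - n)%N => [|d IHd]; first by rewrite addn0.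
apply: le_trans IHd; rewrite addnS -subr_le0.
by have /andP[] := @log_gapS (n + d) (leq_trans n0 (leq_addr _ _)).
Qed.

Lemma log_gap_nondecr n m : (0 < n)%N -> (n <= m)%N ->
  log_gap n - n%:R^-1 <= log_gap m - m%:R^-1.
Proof.
move=> n0 /subnKC <-; elim: (m - n)%N => [|d IHd]; first by rewrite addn0.
apply: le_trans IHd _; rewrite addnS.
have /andP[+ _] := @log_gapS (n + d) (leq_trans n0 (leq_addr _ _)).
by move: (log_gap _) (log_gap _) (_^-1) (_^-1) => a b c e *; lra.
Qed.

(** From n = 1 on, [log_gap] is nonincreasing while [log_gap n - n^-1] is nondecreasing, so the two
    bracket their common limit. *)
Lemma euler_gamma_bounds n : (0 < n)%N ->
  log_gap n - n%:R^-1 <= euler_gamma R <= log_gap n.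
Proof.
move=> n0; pose u k := log_gap (n + k).
have ugap k : log_gap n - n%:R^-1 <= u k.
  apply: le_trans (log_gap_nondecr n0 (leq_addr k n)) _.
  by rewrite gerBl invr_ge0.
have uu : nonincreasing_seq u.
  move=> a b ab; apply: log_gap_nonincr; first by rewrite addn_gt0 n0.
  by rewrite leq_add2l.
have cu : cvgn u.
  by apply: nonincreasing_is_cvgn => //; exists (log_gap n - n%:R^-1) => _ [k _ <-].
have -> : euler_gamma R = limn u.
  rewrite /euler_gamma; apply: cvg_lim => //.
  have -> : (fun n => \sum_(1 <= k < n.+1) k%:R^-1 - ln n%:R : R) = log_gap.
    apply/funext => k; rewrite /log_gap /harm big_add1 big_mkord; congr (_ - _).
  by rewrite -(cvg_shiftn n); under eq_cvg do rewrite /= addnC.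
apply/andP; split; first by apply: limr_ge => //; exact: nearW.
by have := nonincreasing_cvgn_ge uu cu 0%N; rewrite /u addn0.
Qed.

Lemma harm1_asymp n : (0 < n)%N ->
  `|harm R 1 n - (ln n%:R + euler_gamma R)| <= n%:R^-1.
Proof.
move=> n0; have /andP[] := euler_gamma_bounds n0.
by rewrite /log_gap ler_norml => *; apply/andP; split; lra.
Qed.

(** * Basel's sum *)

Lemma sin_sandwich x : 0 < x < pi / 2 -> cos x * x <= sin x <= x.
Proof.
move=> /andP[x0 xpi].
have [|c] := @MVT R (@sin R) (@cos R) 0 x x0 (fun y _ => is_derive_sin y).
  by apply: continuous_subspaceT => y; exact: continuous_sin.
rewrite in_itv/= => /andP[c0 cx]; rewrite sin0 !subr0 => ->.
apply/andP; split; last by rewrite -[leRHS]mul1r ler_wpM2r// ?cos_le1// ltW.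
rewrite ler_wpM2r//; first exact: ltW.
have := @pi_gt0 R => pi0.
by rewrite ltW// ltr_cos// in_itv/=; apply/andP; split; lra.
Qed.

(** This is cot x <= 1 / x <= 1 / sin x, squared. The gap is 1 whatever x, so over 2^n angles it
    totals 2^n, negligible against the sum of order 4^n. *)
Lemma invsq_sandwich x : 0 < x < pi / 2 -> sin x ^- 2 - 1 <= x ^- 2 <= sin x ^- 2.
Proof.
move=> xpi; have /andP[x0 _] := xpi; have s0 := sin_gt0_pihalf xpi.
have c0 : 0 < cos x.
  by apply: cos_gt0_pihalf; case/andP: xpi => *; apply/andP; split; lra.
have /andP[h1 h2] := sin_sandwich xpi.
apply/andP; split; last first.
  rewrite lef_pV2 ?posrE ?exprn_gt0//.
  by apply: lerXn2r => //; rewrite nnegrE; exact: ltW.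
have -> : sin x ^- 2 - 1 = (cos x / sin x) ^+ 2.
  rewrite expr_div_n cos2sin2.
  by field; exact: lt0r_neq0.
have r0 : 0 <= cos x / sin x by rewrite divr_ge0// ltW.
rewrite -exprVn lerXn2r ?nnegrE ?invr_ge0//; first exact: ltW.
by rewrite ler_pdivrMr// -ler_pdivrMl ?invr_gt0// invrK mulrC.
Qed.

(* The duplication formula gives [csc_sum (n + 1) = 4 * csc_sum n]; comparing
   [1 / sin x ^ 2] with [1 / x ^ 2] then yields Basel's sum over odd integers. *)
Definition csc_sum n : R :=
  \sum_(k < 2 ^ n) sin (k.*2.+1%:R * pi / (4 * 2 ^+ n)) ^- 2.

Lemma csc_angle n k : (k < 2 ^ n)%N -> 0 < (k.*2.+1%:R * pi / (4 * 2 ^+ n) : R) < pi / 2.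
Proof.
move=> kn; have pi0 := @pi_gt0 R.
have p0 : 0 < 2 ^+ n :> R by rewrite exprn_gt0.
rewrite divr_gt0 ?mulr_gt0//=.
rewrite ltr_pdivrMr ?mulr_gt0// mulrC.
have -> : pi / 2 * (4 * 2 ^+ n) = pi * (2 * 2 ^+ n) :> R by field.
rewrite ltr_pM2l// -exprS -natrX ltr_nat expnS mul2n.
by rewrite -doubleS leq_double.
Qed.

Lemma csc_sumS n : csc_sum n.+1 = 4 * csc_sum n.
Proof.
have p0 : 2 ^+ n != 0 :> R by rewrite expf_neq0.
rewrite /csc_sum expnS mul2n -addnn big_split_ord/=.
(* Reversing the second half of the angles pairs x with pi / 2 - x, and 1 / sin^2 x + 1 / cos^2 x =
   4 / sin^2 (2x). *)
rewrite [X in _ + X](reindex_inj rev_ord_inj)/= -big_split/= mulr_sumr.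
apply: eq_bigr => k _.
set x : R := k.*2.+1%:R * pi / (4 * 2 ^+ n.+1).
have xpi : 0 < x < pi / 2.
  apply: csc_angle; rewrite expnS mul2n -addnn.
  by rewrite (leq_trans (ltn_ord k)) ?leq_addr.
have -> : (2 ^ n + (2 ^ n - k.+1)).*2.+1%:R * pi / (4 * 2 ^+ n.+1) = pi / 2 - x :> R.
  rewrite -!muln2 -natr1 natrM natrD natrB// natrX /x -!muln2 exprS.
  rewrite -(natr1 (k * 2)) natrM -(natr1 k).
  by field.
have -> : k.*2.+1%:R * pi / (4 * 2 ^+ n) = x *+ 2 :> R.
  by rewrite -mulr_natr /x exprS; field.
rewrite sin_mulr2n sinB sin_pihalf cos_pihalf mul1r mul0r subr0.
have s0 := lt0r_neq0 (sin_gt0_pihalf xpi).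
have c0 : cos x != 0.
  apply: lt0r_neq0; apply: cos_gt0_pihalf; case/andP: xpi => *.
  by apply/andP; split; lra.
rewrite -[_ *+ 2]mulr_natr; have := cos2Dsin2 x => h.
have -> : sin x ^- 2 + cos x ^- 2 = (cos x ^+ 2 + sin x ^+ 2) / (sin x ^+ 2 * cos x ^+ 2).
  by field; rewrite s0 c0.
rewrite h; field; by rewrite s0 c0.
Qed.

Lemma csc_sumE n : csc_sum n = 2 * 4 ^+ n.
Proof.
elim: n => [|n IHn]; last by rewrite csc_sumS IHn exprS; ring.
rewrite /csc_sum expn0 big_ord1 double0 expr0 !mulr1 mul1r.
have := @cos2Dsin2 R (pi / 4); have := @tan_piquarter R.
have c0 : cos (pi / 4) != 0 :> R.
  have pi0 := @pi_gt0 R.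
  by apply: lt0r_neq0; apply: cos_gt0_pihalf; apply/andP; split; lra.
rewrite /tan => /(congr1 (fun y => y * cos (pi / 4))); rewrite divfK// mul1r => ->.
move=> h; have -> : cos (pi / 4) ^+ 2 = 2^-1 :> R by lra.
by rewrite invrK.
Qed.

Definition odd_harm n : R := \sum_(k < n) k.*2.+1%:R ^- 2.

Lemma odd_harm_bounds n :
  pi ^+ 2 / 8 - pi ^+ 2 / 16 / 2 ^+ n <= odd_harm (2 ^ n) <= pi ^+ 2 / 8.
Proof.
have pi0 := @pi_gt0 R; have pn : 0 < 2 ^+ n :> R by rewrite exprn_gt0.
have pn0 := lt0r_neq0 pn; have pi_neq0 := lt0r_neq0 pi0.
(* The square of the factor pi / (4 * 2^n) of the angles: c times 2 * 4^n is pi^2 / 8, and c times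
   the number 2^n of angles is the error. *)
set c : R := pi ^+ 2 / (16 * 4 ^+ n).
have c0 : 0 <= c.
  by apply: divr_ge0; [exact/exprn_ge0/pi_ge0|rewrite mulr_ge0// exprn_ge0].
have four : 4 ^+ n = 2 ^+ n ^+ 2 :> R by rewrite -exprM mulnC exprM; congr (_ ^+ _); ring.
have E : odd_harm (2 ^ n) = c * \sum_(k < 2 ^ n) (k.*2.+1%:R * pi / (4 * 2 ^+ n)) ^- 2.
  rewrite mulr_sumr; apply: eq_bigr => k _; rewrite /c four.
  have : k.*2.+1%:R != 0 :> R by rewrite pnatr_eq0.
  move: (k.*2.+1%:R) (2 ^+ n) pn0 (pi : R) pi_neq0 => a b b0 q q0 a0. field.
  by rewrite a0 b0 q0.
have u : pi ^+ 2 / 8 = c * csc_sum n.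
  by rewrite csc_sumE /c; field; rewrite expf_neq0.
have v : pi ^+ 2 / 16 / 2 ^+ n = c * \sum_(k < 2 ^ n) 1.
  by rewrite sumr_const card_ord natrX /c four; field.
rewrite E u v -mulrBr -sumrB; apply/andP; split; apply: ler_wpM2l => //;
  apply: ler_sum => k _; by have /andP[] := invsq_sandwich (csc_angle (ltn_ord k)).
Qed.

Lemma harm2_split n : harm R 2 n.*2 = odd_harm n + harm R 2 n / 4.
Proof.
elim: n => [|n IHn]; first by rewrite /harm /odd_harm !big_ord0 mul0r addr0.
rewrite doubleS 2!harmS {}IHn harmS /odd_harm big_ord_recr/= -/(odd_harm n).
have -> : n.*2.+2%:R = 2 * n.+1%:R :> R by rewrite -doubleS -muln2 natrM mulrC.
have n0 : n.+1%:R != 0 :> R by rewrite pnatr_eq0.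
have n1 : n.*2.+1%:R != 0 :> R by rewrite pnatr_eq0.
by move: n.+1%:R n.*2.+1%:R n0 n1 => a b a0 b0; field; rewrite a0 b0.
Qed.

(** Splitting into odd and even integers along the powers of 2, the limit l satisfies l = pi^2 / 8 +
    l / 4. *)
Lemma basel : harm R 2 n @[n --> \oo] --> pi ^+ 2 / 6.
Proof.
have ch : cvgn (harm R 2).
  apply: nondecreasing_is_cvgn; first by move=> a b; exact: le_harm.
  by exists 2 => _ [k _ <-]; exact: harm2_le2.
have pown : (2 ^ n)%N @[n --> \oo] --> \oo.
  apply/cvgnyPge => A; near=> n; apply: leq_trans (ltnW (ltn_expl n (isT : 1 < 2)%N)).
  by near: n; exact: nbhs_infty_ge.
have [l cl] : exists l : R, harm R 2 n @[n --> \oo] --> l.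
  by exists (limn (harm R 2)).
have c1 : harm R 2 (2 ^ n) @[n --> \oo] --> l by apply: cvg_comp pown cl.
have c2 : harm R 2 (2 ^ n.+1) @[n --> \oo] --> l.
  by rewrite (cvg_shiftS (fun n => harm R 2 (2 ^ n)%N)).
have c3 : odd_harm (2 ^ n) @[n --> \oo] --> pi ^+ 2 / 8.
  apply: (@squeeze_cvgr _ _ _ _ (fun n => pi ^+ 2 / 8 - pi ^+ 2 / 16 / 2 ^+ n)
            (fun=> pi ^+ 2 / 8)).
  - by apply: nearW => n; exact: odd_harm_bounds.
  - rewrite -[X in _ --> X]subr0; apply: cvgB; first exact: cvg_cst.
    rewrite -(mulr0 (pi ^+ 2 / 16)); apply: cvgMr.
    under eq_cvg do rewrite -exprVn.
    by apply: cvg_expr; rewrite ger0_norm ?invr_ge0// invf_lt1// ltr1n.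
  - exact: cvg_cst.
have c4 : harm R 2 (2 ^ n.+1) @[n --> \oo] --> pi ^+ 2 / 8 + l / 4.
  under eq_cvg do rewrite expnS mul2n harm2_split.
  by apply: cvgD => //; apply: cvgMl.
have e : l = pi ^+ 2 / 8 + l / 4 by apply: cvg_unique c2 c4.
by have -> : pi ^+ 2 / 6 = l by lra.
Unshelve. all: by end_near. Qed.

Lemma harm2_asymp n : (0 < n)%N -> `|harm R 2 n - pi ^+ 2 / 6| <= n%:R^-1.
Proof.
move=> n0; have l : limn (harm R 2) = pi ^+ 2 / 6 := cvg_lim (@Rhausdorff R) basel.
have c : cvgn (harm R 2) := cvgP _ basel.
have h1 : harm R 2 n <= pi ^+ 2 / 6.
  by rewrite -l; apply: nondecreasing_cvgn_le => // a b; exact: le_harm.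
have h2 : pi ^+ 2 / 6 <= harm R 2 n + n%:R^-1.
  rewrite -l; apply: limr_le => //; near=> m.
  rewrite -lerBlDl; apply: le_trans (harm2_tail R n0 _) _.
    by near: m; exact: nbhs_infty_ge.
  by rewrite gerBl invr_ge0.
by rewrite ler_norml; apply/andP; split; lra.
Unshelve. all: by end_near. Qed.
End HarmonicAsymptotics.

(** * Counting surjections *)

Section Counting.
Variable R : realFieldType.
Implicit Types (N k : nat).

Lemma sum_tuple_cons (T : finType) k (f : k.+1.-tuple T -> nat) :
  (\sum_t f t = \sum_(t : k.-tuple T) \sum_(x : T) f [tuple of x :: t])%N.
Proof.
rewrite exchange_big pair_big/=.
rewrite (reindex (fun u : T * k.-tuple T => [tuple of u.1 :: u.2]))//=.
exists (fun t => (thead t, [tuple of behead t])) => [[x t] _|t _] /=.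
  by rewrite theadE; congr (_, _); apply: val_inj.
by rewrite -tuple_eta.
Qed.

Lemma sum_card_setU1 (T : finType) (A : {set T}) (i : nat) :
  (\sum_(x : T) (#|(x |: A)%SET| == i) =
   (#|A| == i) * i + (#|A|.+1 == i) * (#|T| - #|A|))%N.
Proof.
rewrite (bigID (mem A))/=; congr (_ + _)%N.
  under eq_bigr => x xA do rewrite cardsU1 xA add0n.
  by rewrite sum_nat_const mulnC; case: eqP => [->//|]; rewrite !mul0n.
under eq_bigr => x xA do rewrite cardsU1 xA add1n.
rewrite sum_nat_const mulnC; congr (_ * _)%N.
by rewrite -(cardC (mem A)) addKn; apply: eq_card => x; rewrite !inE.
Qed.

(** A word with i types is extended by one letter without a new type in i ways and with one in N - i
    ways: the recursion of [occ], multiplied by N at each draw. *)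
Lemma card_occ N k (i : nat) : (0 < N)%N ->
  #|[set t : k.-tuple 'I_N | #|[set x in t]%SET| == i]%SET|%:R =
  N%:R ^+ k * occ R N k i.
Proof.
move=> N0; have NR : N%:R != 0 :> R by rewrite pnatr_eq0 -lt0n.
have cardE n (Q : pred (n.-tuple 'I_N)) : #|[set t | Q t]%SET| = (\sum_t Q t)%N.
  by rewrite -sum1dep_card big_mkcond/=; apply: eq_bigr => t _; case: (Q t).
elim: k i => [|k IHk] i.
  rewrite cardE (bigD1 [tuple])//= big1 ?addn0 => [|t]; last first.
    by move/eqP; case; exact: tuple0.
  rewrite expr0 mul1r; congr (_%:R); congr (nat_of_bool _).
  by rewrite eq_sym; congr (_ == _); apply: eq_card0 => x; rewrite !inE.
rewrite cardE sum_tuple_cons.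
under eq_bigr => t _.
  have E x : [set y in [tuple of x :: t]]%SET = (x |: [set y in t])%SET.
    by apply/setP => y; rewrite !inE.
  under eq_bigr do rewrite E.
  rewrite sum_card_setU1 card_ord.
  over.
rewrite big_split/= natrD mulrDr; congr (_ + _).
  rewrite -big_distrl/= natrM -cardE IHk exprS; field.
  exact: NR.
case: i => [|i].
  by rewrite big1 ?mulr0.
have -> : (\sum_(t : k.-tuple 'I_N) (#|[set y in t]%SET|.+1 == i.+1) * (N - #|[set y in t]%SET|)
  = \sum_(t : k.-tuple 'I_N) (#|[set y in t]%SET| == i) * (N - i))%N.
  by apply: eq_bigr => t _; rewrite eqSS; case: eqP => [->|].
rewrite -big_distrl/= natrM -cardE IHk exprS; field.
exact: NR.
Qed.

(** Through its fibers, a word using all types becomes a partition of the positions whose blocks are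
    labelled injectively by the types. *)
Definition fibers N k (t : k.-tuple 'I_N) : {ffun 'I_N -> {set 'I_k}} :=
  [ffun c => [set i | tnth t i == c]%SET].

Lemma fibers_inj N k : injective (@fibers N k).
Proof.
move=> t u tu; apply: eq_from_tnth => i.
have /setP/(_ i) := congr1 (fun f : {ffun 'I_N -> {set 'I_k}} => f (tnth t i)) tu.
by rewrite !ffunE !inE eqxx => /esym/eqP.
Qed.

Lemma seenP N k (t : k.-tuple 'I_N) :
  reflect (forall c, exists i, tnth t i = c) (#|[set x in t]%SET| == N).
Proof.
apply: (iffP eqP) => [tN c|tall].
  have /setP/(_ c) : [set x in t]%SET = [set: 'I_N]%SET.
    by apply/eqP; rewrite eqEcard finset.subsetT cardsT card_ord tN /=.
  by rewrite !inE => /tnthP[i ->]; exists i.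
have -> : [set x in t]%SET = [set: 'I_N]%SET; last by rewrite cardsT card_ord.
by apply/setP => c; rewrite !inE; have [i <-] := tall c; exact: mem_tnth.
Qed.

Lemma fibers_surj N k :
  [set fibers t | t in [set t : k.-tuple 'I_N | #|[set x in t]%SET| == N]]%SET =
  [set h : {ffun 'I_N -> {set 'I_k}} | injectiveb h &
    finset.partition [set h c | c in 'I_N]%SET [set: 'I_k]]%SET.
Proof.
apply/setP => h; rewrite [RHS]inE; apply/imsetP/andP => [[t]|[/injectiveP hinj]].
  rewrite inE => /seenP tall ->; split.
    apply/injectiveP => c c' /setP cc; have [i ic] := tall c.
    by have := cc i; rewrite !ffunE !inE ic eqxx => /esym/eqP.
  apply/and3P; split.
  - apply/eqP/setP => i; rewrite !inE; apply/bigcupP.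
    by exists (fibers t (tnth t i)); [exact: imset_f|rewrite ffunE inE].
  - apply/finset.trivIsetP => _ _ /imsetP[c _ ->] /imsetP[c' _ ->].
    apply: contraR => /pred0Pn[i] /=; rewrite !ffunE !inE => /andP[/eqP <- /eqP <-].
    by [].
  - apply/negP => /imsetP[c _]; have [i ic] := tall c.
    by move/setP/(_ i); rewrite ffunE !inE ic eqxx.
case/and3P => /eqP hcov /finset.trivIsetP htriv h0.
have hex (i : 'I_k) : exists c, i \in h c.
  have : i \in finset.cover [set h c | c in 'I_N]%SET by rewrite hcov inE.
  by case/bigcupP => _ /imsetP[c _ ->] ic; exists c.
pose t := [tuple xchoose (hex i) | i < k].
have tE i c : (tnth t i == c) = (i \in h c).
  rewrite tnth_mktuple; apply/eqP/idP => [<-|ic]; first exact: (xchooseP (hex i)).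
  apply: hinj; apply: contraTeq ic => ne.
  have := htriv _ _ (imset_f h (erefl (xchoose (hex i) \in 'I_N))) (imset_f h (erefl (c \in 'I_N))) ne.
  by move/pred0P/(_ i) => /=; rewrite (xchooseP (hex i)) /= => ->.
exists t; last by apply/ffunP => c; apply/setP => i; rewrite ffunE inE tE.
rewrite inE; apply/seenP => c.
have : h c != finset.set0.
  by apply: contra h0 => /eqP <-; exact: imset_f.
by case/set0Pn => i; rewrite -tE => /eqP ic; exists i.
Qed.

(** Grouping by the unlabelled partition, each one with [N] blocks has N! labellings. *)
Lemma card_surj N k :
  #|[set t : k.-tuple 'I_N | #|[set x in t]%SET| == N]%SET| = (stirling2 k N * N`!)%N.
Proof.
pose blocks := [set Q : {set {set 'I_k}} |
  finset.partition Q [set: 'I_k] & #|Q| == N]%SET.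
pose im (h : {ffun 'I_N -> {set 'I_k}}) := [set h c | c in 'I_N]%SET.
rewrite -(card_imset _ (@fibers_inj N k)) fibers_surj -sum1_card.
rewrite (partition_big im (mem blocks)) /=; last first.
  move=> h; rewrite !inE => /andP[/injectiveP hinj ->] /=.
  by rewrite card_imset// card_ord.
rewrite /stirling2 -sum_nat_const; apply: eq_bigr => Q.
rewrite inE => /andP[Qp /eqP QN].
rewrite sum1dep_card -ffactnn -[in X in _ = (X ^_ _)%N]QN -[X in _ = (_ ^_ X)%N]card_ord.
rewrite -card_inj_ffuns_on; apply: eq_card => h; rewrite !inE.
apply/andP/andP => [[/andP[hinj _] /eqP <-]|[/ffun_onP hQ hinj]].
  by split=> //; apply/ffun_onP => c; exact: imset_f.
have hi : injective h by exact/injectiveP.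
have imQ : im h = Q.
  apply/eqP; rewrite eqEcard card_imset// card_ord QN leqnn andbT.
  by apply/fintype.subsetP => _ /imsetP[c _ ->].
by rewrite hinj -/(im h) imQ Qp eqxx.
Qed.

Lemma fullE_stirling N k : (0 < N)%N ->
  full R N k = (stirling2 k N)%:R * N`!%:R / N%:R ^+ k.
Proof.
move=> N0; rewrite -natrM -card_surj card_occ// mulrC mulKf//.
by rewrite expf_neq0// pnatr_eq0 -lt0n.
Qed.
End Counting.

(** * The law of the collection time *)

Section CollectionLaw.
Variable R : realType.

Lemma prode_const (I : Type) (s : seq I) (x : R) :
  (\prod_(i <- s) x%:E = (x ^+ size s)%:E)%E.
Proof.
elim: s => [|i s IHs]; first by rewrite big_nil.
by rewrite big_cons IHs /= exprS EFinM.
Qed.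

Lemma sume_const (I : Type) (s : seq I) (x : R) :
  (\sum_(i <- s) x%:E = ((size s)%:R * x)%:E)%E.
Proof. by rewrite sumEFin big_const_seq count_predT iter_addr_0 mulr_natl. Qed.

Section Draws.
Context (d : measure_display) (Om : measurableType d) (P : probability Om R).
Variables (N : nat) (Y : nat -> Om -> 'I_N).
Hypotheses (N0 : (0 < N)%N) (hY : uniform_draws P Y).

Definition cylinder k (t : k.-tuple 'I_N) : set Om :=
  [set w | forall i : 'I_k, Y i w = tnth t i].

Lemma measurable_cylinder k (t : k.-tuple 'I_N) : measurable (cylinder t).
Proof.
have -> : cylinder t = \bigcap_(i in [set: 'I_k]) (Y i @^-1` [set tnth t i]).
  by apply/seteqP; split => w /= h i; [move=> _; exact: h|exact: (h i I)].
by apply: fin_bigcap_measurable => // i _; case: hY.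
Qed.

Lemma prob_cylinder k (t : k.-tuple 'I_N) : P (cylinder t) = (N%:R^-1 ^+ k)%:E.
Proof.
have [_ hu hi] := hY; pose c0 := Ordinal N0.
pose J := [fset i | i in iota 0 k]%fset.
pose A i := Y i @^-1` [set nth c0 t i].
have -> : cylinder t = \bigcap_(i in [set` J]) A i.
  apply/seteqP; split => w /= h.
    move=> i; rewrite /= !inE mem_iota add0n => /andP[_ ik].
    by have := h (Ordinal ik); rewrite (tnth_nth c0).
  move=> i; rewrite (tnth_nth c0); apply: (h i).
  by rewrite /= !inE mem_iota add0n ltn_ord.
rewrite hi; last by move=> i _; exists [set nth c0 t i].
rewrite (eq_bigr (fun=> (N%:R^-1)%:E)) => [|i _]; last exact: hu.
rewrite prode_const; congr (_ ^+ _)%:E.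
by rewrite card_fseq undup_id ?iota_uniq// size_iota.
Qed.

Lemma prob_all_types_seen k :
  P [set w | all_types_seen Y k w] = (full R N k)%:E.
Proof.
pose S := [set t : k.-tuple 'I_N | #|[set x in t]%SET| == N]%SET.
pose A := [fset t | t in enum S]%fset.
have AS t : (t \in A) = (t \in S) by rewrite !inE mem_enum inE.
have -> : [set w | all_types_seen Y k w] = \big[setU/set0]_(t <- A) cylinder t.
  rewrite -bigcup_fset; apply/seteqP; split => w /=.
    move=> h; exists [tuple Y i w | i < k]; last by move=> i /=; rewrite tnth_mktuple.
    rewrite /= AS inE; apply/seenP => c; have [i ik ic] := h c.
    by exists (Ordinal ik); rewrite tnth_mktuple.
  move=> [t]; rewrite /= AS inE => /seenP h tw c.
  by have [i <-] := h c; exists i => //; rewrite tw.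
rewrite measure_fbigsetU; last 2 first.
- by move=> t _; exact: measurable_cylinder.
- move=> t u _ _ [w [tw uw]]; apply: eq_from_tnth => i.
  by rewrite -tw -uw.
rewrite (eq_bigr (fun=> (N%:R^-1 ^+ k)%:E)) => [|t _]; last exact: prob_cylinder.
rewrite sume_const card_fseq undup_id ?enum_uniq// -cardE card_occ//.
by rewrite mulrAC -exprMn divff ?expr1n ?mul1r// pnatr_eq0 -lt0n.
Qed.

End Draws.

Lemma collection_timeP (Om : Type) N (Y : nat -> Om -> 'I_N) w :
  (exists n, [/\ all_types_seen Y n w, forall m, all_types_seen Y m w -> (n <= m)%N
     & collection_time R Y w = n%:R%:E]) \/
  ((forall n, ~ all_types_seen Y n w) /\ collection_time R Y w = +oo%E).
Proof.
have [[n hn]|h] := pselect (exists n, all_types_seen Y n w); last first.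
  right; split; first by move=> n hn; apply: h; exists n.
  rewrite /collection_time [X in ereal_inf X](_ : _ = set0) ?ereal_inf0//.
  by apply/seteqP; split => // x [n hn _]; apply: h; exists n.
left; have ex : exists n, `[<all_types_seen Y n w>] by exists n; apply/asboolP.
case: (ex_minnP ex) => m /asboolP hm mmin; exists m; split=> //.
  by move=> l hl; apply: mmin; apply/asboolP.
apply/eqP; rewrite eq_le; apply/andP; split.
  by apply: ereal_inf_lbound; exists m.
apply: le_ereal_inf_tmp => _ [l hl <-]; rewrite lee_fin ler_nat.
by apply: mmin; apply/asboolP.
Qed.

Lemma all_types_seenW (Om : Type) N (Y : nat -> Om -> 'I_N) w m n :
  (m <= n)%N -> all_types_seen Y m w -> all_types_seen Y n w.
Proof. by move=> mn h c; have [k km kc] := h c; exists k => //; exact: leq_trans mn. Qed.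

Definition naturals : set R := range (fun n : nat => n%:R).

Lemma measurable_naturals : measurable naturals.
Proof.
have -> : naturals = \bigcup_n [set n%:R].
  apply/seteqP; split => x /=; first by move=> [n _ <-]; exists n.
  by move=> [n _ ->]; exists n.
by apply: bigcup_measurable => n _; exact: measurable_set1.
Qed.

Section Law.
Context (d : measure_display) (Om : measurableType d) (P : probability Om R).
Variables (N : nat) (T : {RV P >-> R}).
Hypotheses (N0 : (0 < N)%N) (hT : has_collection_law N T).

Lemma collection_law_naturals : P (T @^-1` naturals) = 1%E.
Proof.
have [d' [Om' [P' [Y [hY law]]]]] := hT.
have := law _ measurable_naturals; rewrite /distribution /pushforward => ->.
have := law _ measurableT; rewrite /distribution /pushforward preimage_setT.
rewrite probability_setT => ->; congr (P' _).
apply/seteqP; split => w /= [r hr e]; exists r => //.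
case: (collection_timeP Y w) => [[n [_ _ en]]|[_]]; last by rewrite e.
by exists n => //; apply/EFin_inj; rewrite -en.
Qed.

Lemma collection_law_gt k : P (T @^-1` [set x | k%:R < x]) = (1 - full R N k)%:E.
Proof.
have [d' [Om' [P' [Y [hY law]]]]] := hT.
have mle : measurable [set x : R | x <= k%:R].
  by have -> : [set x : R | x <= k%:R] = [set` `]-oo, k%:R]] by apply/seteqP; split => x; rewrite /= in_itv.
have -> : T @^-1` [set x | k%:R < x] = ~` (T @^-1` [set x | x <= k%:R]).
  by apply/seteqP; split => w /=; rewrite ltNge => /negP.
rewrite probability_setC; last by rewrite -[X in measurable X]setTI; exact: measurable_funPT.
have := law _ mle; rewrite /distribution /pushforward => ->.
rewrite EFinB; congr (_ - _)%E; rewrite -(prob_all_types_seen N0 hY k); congr (P' _).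
apply/seteqP; split => w /=.
  move=> [r rk e]; case: (collection_timeP Y w) => [[n [hn _ en]]|[_]]; last by rewrite e.
  apply: (all_types_seenW _ hn); rewrite -(ler_nat R).
  by move: en; rewrite e => -[<-].
move=> h; case: (collection_timeP Y w) => [[n [hn nmin en]]|[/(_ k)//]].
by exists n%:R => //; rewrite ler_nat; exact: nmin.
Qed.
End Law.

Lemma ae_prob1 (d : measure_display) (Om : measurableType d) (P : probability Om R)
    (A : set Om) : measurable A -> P A = 1%E -> {ae P, forall w, A w}.
Proof.
move=> mA PA; exists (~` A); split => //; first exact: measurableC.
by rewrite probability_setC// PA subee.
Qed.

Lemma nneseries_count (v : nat -> R) n :
  (\sum_(0 <= k <oo) (v k * (k < n)%N%:R)%:E = (\sum_(k < n) v k)%:E)%E.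
Proof.
apply: lim_near_cst => //; near=> m.
have nm : (n <= m)%N by near: m; exact: nbhs_infty_ge.
rewrite (@big_cat_nat _ _ _ n)//= [X in (_ + X)%E]big_nat_cond [X in (_ + X)%E]big1 ?adde0.
  rewrite big_mkord sumEFin; congr (_%:E); apply: eq_bigr => k _.
  by rewrite ltn_ord mulr1.
by move=> k /andP[/andP[nk _] _]; rewrite ltnNge nk mulr0.
Unshelve. all: by end_near. Qed.

(** Almost surely Z is the sum over all k of v k times the indicator of k < X, and nonnegative
    series integrate termwise. The weights 1 give X and 2k + 1 give X^2. *)
Lemma expectation_tail_series (d : measure_display) (Om : measurableType d)
    (P : probability Om R) (X Z : Om -> R) (v : nat -> R) :
  measurable_fun setT X -> measurable_fun setT Z -> (forall k, 0 <= v k) ->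
  {ae P, forall w, exists n : nat, X w = n%:R /\ Z w = \sum_(k < n) v k} ->
  ('E_P[Z] = \sum_(0 <= k <oo) ((v k)%:E * P [set w | (k%:R < X w)%R]))%E.
Proof.
move=> mX mZ v0 h; rewrite unlock.
pose A k := [set w | k%:R < X w].
have mA k : measurable (A k).
  rewrite -[A k]setTI; have -> : A k = X @^-1` [set` `]k%:R, +oo[].
    by apply/seteqP; split => w; rewrite /A /= in_itv/= andbT.
  exact: mX.
pose f k : Om -> \bar R := fun w => (v k * \1_(A k) w)%:E.
have f0 k w : (0 <= f k w)%E by rewrite lee_fin mulr_ge0.
have mf k : measurable_fun [set: Om] (f k : Om -> \bar R).
  apply/measurable_EFinP; apply: measurable_funM; first exact: measurable_cst.
  exact: measurable_indic.
rewrite (@ae_eq_integral _ _ _ P setT (fun w => \sum_(0 <= k <oo) f k w)%E)//=.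
- rewrite integral_nneseries//; apply: eq_eseriesr => k _.
  under eq_integral do rewrite /f EFinM.
  rewrite ge0_integralZl_EFin//; last first.
    by apply/measurable_EFinP; exact: measurable_indic.
  by rewrite integral_indic// setIT.
- exact/measurable_EFinP.
- exact: ge0_emeasurable_sum.
- apply: filterS h => w [n [Xn ->]] _ /=.
  rewrite -nneseries_count; apply: eq_eseriesr => k _; rewrite /f indicE; congr (_ * _)%:E.
  have -> : (w \in A k) = (k < n)%N; last by [].
  by apply/idP/idP; rewrite inE /A/= Xn ltr_nat.
Qed.
End CollectionLaw.

(** * Asymptotics of the survival series *)

Section SurvivalAsymptotics.
Variable R : realType.
Implicit Types (N k j m n p X : nat) (x y : R).

Lemma nneseries_near (u : nat -> R) A E C : (forall k, 0 <= u k) ->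
  (forall X, (0 < X)%N -> `|\sum_(k < X) u k - A| <= E + C / X%:R) ->
  exists2 x : R, (\sum_(0 <= k <oo) (u k)%:E = x%:E)%E & `|x - A| <= E.
Proof.
move=> u0 h; pose S X := \sum_(k < X) u k.
have S_nd : nondecreasing_seq S.
  apply/nondecreasing_seqP => n; by rewrite /S big_ord_recr/= lerDl.
have S_ub : has_ubound (range S).
  exists (A + (E + `|C|)) => _ [[|X] _ <-].
    apply: le_trans (S_nd 0%N 1%N isT) _.
    have := h 1%N isT; rewrite divr1 ler_norml => /andP[_]; rewrite -/(S 1%N).
    by have := ler_norm C; lra.
  have := h X.+1 isT; rewrite -/(S X.+1) ler_norml => /andP[_].
  have : C / X.+1%:R <= `|C|.
    apply: le_trans (ler_norm _) _; rewrite normrM ler_piMr//.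
    by rewrite ger0_norm ?invr_ge0// invf_le1 ?ler1n// ltr0n.
  by move: (C / _) => x *; lra.
have S_cvg : cvgn S := nondecreasing_is_cvgn S_nd S_ub.
exists (limn S).
  rewrite -EFin_lim//; congr (limn _); apply/funext => n /=.
  by rewrite sumEFin big_mkord.
have c1 : `|S X - A| @[X --> \oo] --> `|limn S - A|.
  by apply: cvg_norm; apply: cvgB => //; exact: cvg_cst.
have c2 : (E + C / X%:R) @[X --> \oo] --> E.
  rewrite -[X in _ --> X]addr0; apply: cvgD; first exact: cvg_cst.
  rewrite -(mulr0 C); apply: cvgMr.
  by rewrite -(cvg_shiftS (fun L : nat => L%:R^-1 : R)); exact: cvg_harmonic.
apply: ler_cvg_to c1 c2 _; near=> X; apply: h; near: X; exact: nbhs_infty_gt.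
Unshelve. all: by end_near. Qed.

(** From 1 - 1/2 <= exp(-1/2) follows e <= 4. Hence the threshold 4 <= N below, under which powers
    of ln N absorb constants. *)
Lemma ln4_ge1 : 1 <= ln (4 : R).
Proof.
have h : expR (2^-1) <= 2 :> R.
  have := expR_ge1Dx (- 2^-1 : R); rewrite expRN => e.
  have e0 := expR_gt0 (2^-1 : R).
  have : 2^-1 <= (expR 2^-1)^-1 :> R by lra.
  by rewrite lef_pV2 ?posrE.
rewrite -[leLHS]expRK ler_ln ?posrE ?expR_gt0//.
have -> : 1 = 2^-1 + 2^-1 :> R by lra.
rewrite expRD; have e0 := expR_gt0 (2^-1 : R); nra.
Qed.

Lemma ln_ge1 N : (4 <= N)%N -> 1 <= ln (N%:R : R).
Proof.
by move=> N4; apply: le_trans ln4_ge1 _; rewrite ler_ln ?posrE ?ltr0n ?ler_nat// (leq_trans _ N4).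
Qed.

Lemma tail_range_le p N j : (0 < j <= p)%N -> (p <= N)%N -> (4 <= N)%N ->
  0 <= 8 * (j * N)%:R * ln ((j * N)%:R : R) <= 16 * p%:R * N%:R * ln (N%:R : R).
Proof.
move=> /andP[j0 jp] pN N4; have N0 : (0 < N)%N by apply: leq_trans N4.
have jN0 : (0 < j * N)%N by rewrite muln_gt0 j0.
have l0 : 0 <= ln ((j * N)%:R : R) by rewrite ln_ge0// ler1n.
have l2 : ln ((j * N)%:R : R) <= 2 * ln (N%:R : R).
  have -> : 2 * ln N%:R = ln (N%:R ^+ 2) :> R by rewrite lnXn ?ltr0n// mulr_natl.
  rewrite ler_ln ?posrE ?exprn_gt0 ?ltr0n//.
  by rewrite -natrX ler_nat expnS expn1 leq_pmul2r// (leq_trans jp).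
have L1 := ln_ge1 N4.
rewrite !mulr_ge0//=.
have -> : 16 * p%:R * N%:R * ln (N%:R : R) = 8 * (p * N)%:R * (2 * ln N%:R).
  by rewrite natrM; ring.
by apply: ler_pM => //; rewrite ?mulr_ge0// ler_wpM2l// ler_nat leq_mul2r jp orbT.
Qed.

(** Since 1 <= p L and 1 <= p N L, the constants are 17 = 16 + 1, 33 = 2 * 16 + 1 and 65 = 4 * 16 +
    1. The 16 itself is 8 * 2, as ln(j N) <= 2 ln N for j <= p <= N. *)
Lemma window_bounds p N K (L := ln (N%:R : R)) : (0 < p)%N -> (4 <= N)%N ->
  0 <= K <= 16 * p%:R * N%:R * L ->
  [/\ K + 1 <= 17 * (p%:R * N%:R * L), 2 * K + 1 <= 33 * (p%:R * N%:R * L) &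
    0 <= N%:R^-1 + 4 * K / N%:R ^+ 2 <= 65 * (p%:R * L) / N%:R].
Proof.
move=> p0 N4 /andP[K0 K1].
have L1 : 1 <= L := ln_ge1 N4.
have N1 : 1 <= N%:R :> R by rewrite ler1n (leq_trans _ N4).
have p1 : 1 <= p%:R :> R by rewrite ler1n.
have NR : 0 < N%:R :> R by lra.
have pL1 : 1 <= p%:R * L by rewrite mulr_ege1.
have pNL1 : 1 <= p%:R * N%:R * L by rewrite mulr_ege1// mulr_ege1.
split; [lra|lra|apply/andP; split].
  by rewrite addr_ge0 ?invr_ge0// divr_ge0 ?exprn_ge0// mulr_ge0.
rewrite -(ler_pM2r NR) divfK ?lt0r_neq0// mulrDl mulVf ?lt0r_neq0//.
have -> : 4 * K / N%:R ^+ 2 * N%:R = 4 * K / N%:R by field; exact: lt0r_neq0.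
have : 4 * K / N%:R <= 64 * (p%:R * L) by rewrite ler_pdivrMr//; lra.
lra.
Qed.

(* The numerical factors are those of [window_bounds]. *)
Definition mean_cst p : R := 17 * 65 * p%:R ^+ 2 + 288 * expR 1.
Definition mom2_cst p : R := 17 * 33 * 65 * p%:R ^+ 3 + 288 * expR 1.

Lemma power_mean p N j : (0 < j <= p)%N -> (p <= N)%N -> (4 <= N)%N ->
  exists C, forall X, (0 < X)%N ->
  `|j%:R * (\sum_(k < X) (1 - full R N k ^+ j)) - (j * N)%:R * harm R 1 (j * N)| <=
  mean_cst p * ln N%:R ^+ 2 + C / X%:R.
Proof.
move=> jp pN N4; have /andP[j0 jp'] := jp.
have N0 : (0 < N)%N by apply: leq_trans N4.
have jN0 : (0 < j * N)%N by rewrite muln_gt0 j0.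
have H0 := harm_ge0 R 1 (j * N).
set A := _ * harm R 1 _; have A0 : 0 <= A by rewrite mulr_ge0.
set C := A * 6 * (j * N)%:R ^+ 4; exists C.
have C0 : 0 <= C by rewrite !mulr_ge0// exprn_ge0.
move=> X X0.
under eq_bigr do rewrite -[1 - _]mul1r.
apply: (@power_survival_sum R N j (fun=> 1) (fun=> 1)) => //.
- by move=> k; rewrite sumr_const card_ord mulr1.
- move=> X'; have /andP[K0 K1] := tail_range_le jp pN N4.
  have wm m : 0 <= (1 : R) <= m.*2.+1%:R by rewrite ler01 ler1n.
  have := @sum_scaling_error R N j (fun=> 1) 1 X' N0 j0 wm (fun m _ => lexx 1).
  move/le_trans; apply; move: (8 * _ * _) K0 K1 => K K0 K1.
  have L1 := ln_ge1 N4; have N0R : 0 < N%:R :> R by rewrite ltr0n.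
  have [|h1 h3 /andP[B0 h2]] := @window_bounds p N K (leq_trans j0 jp') N4.
    by rewrite K0 K1.
  set L := ln N%:R in L1 h1 h2 h3 *.
  rewrite mul1r /mean_cst [leRHS]mulrDl; apply: lerD.
    apply: (@le_trans _ _ (17 * (p%:R * N%:R * L) * (65 * (p%:R * L) / N%:R))).
      by apply: ler_pM => //; lra.
    by rewrite le_eqVlt; apply/orP; left; apply/eqP; field; exact: lt0r_neq0.
  by rewrite ler_peMr ?mulr_ge0 ?expR_ge0// expr_ge1 ?(le_trans _ L1).
- move=> X' X'0; have /andP[a1 a2] := mean_full_bounds R X' jN0.
  have := tail_le jN0 X'0 (lexx 0) A0; rewrite mul0r !add0r => t.
  rewrite -/A in a1 a2.
  under eq_bigr do rewrite mul1r.
  by rewrite a2 andbT; apply: le_trans a1; rewrite lerD2l lerN2.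
Qed.

Lemma power_mom2 p N j : (0 < j <= p)%N -> (p <= N)%N -> (4 <= N)%N ->
  exists C, forall X, (0 < X)%N ->
  `|j%:R ^+ 2 * (\sum_(k < X) k.*2.+1%:R * (1 - full R N k ^+ j)) -
    mom2 R (j * N) (j * N)| <=
  mom2_cst p * (N%:R * ln N%:R ^+ 3) + C / X%:R.
Proof.
move=> jp pN N4; have /andP[j0 jp'] := jp.
have N0 : (0 < N)%N by apply: leq_trans N4.
have jN0 : (0 < j * N)%N by rewrite muln_gt0 j0.
have H0 := harm_ge0 R 1 (j * N).
set a := 2 * ((j * N)%:R * harm R 1 (j * N)).
have a0 : 0 <= a by rewrite !mulr_ge0.
set b := (j * N)%:R ^+ 2 * (harm R 1 (j * N) ^+ 2 + harm R 2 (j * N)).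
have b0 : 0 <= b by rewrite mulr_ge0 ?exprn_ge0// addr_ge0 ?harm_ge0// exprn_ge0.
set C := (a + b) * 6 * (j * N)%:R ^+ 4; exists C.
have C0 : 0 <= C by rewrite !mulr_ge0 ?addr_ge0// exprn_ge0.
move=> X X0.
apply: (@power_survival_sum R N j (fun m => m.*2.+1%:R) (fun k => k.*2.+1%:R)
  (j%:R ^+ 2)) => //.
- by move=> k; rewrite sum_odd_block -muln2 -natr1 !natrD !natrM; ring.
- move=> X'; have /andP[K0 K1] := tail_range_le jp pN N4.
  have wm m : 0 <= (m.*2.+1%:R : R) <= m.*2.+1%:R by rewrite lexx andbT.
  have := @sum_scaling_error R N j (fun m => m.*2.+1%:R)
     (2 * (8 * (j * N)%:R * ln ((j * N)%:R)) + 1) X' N0 j0 wm.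
  have wK m : m%:R <= 8 * (j * N)%:R * ln ((j * N)%:R : R) ->
      m.*2.+1%:R <= 2 * (8 * (j * N)%:R * ln ((j * N)%:R : R)) + 1.
    have -> : m.*2.+1%:R = 2 * m%:R + 1 :> R by rewrite -muln2 -natr1 natrM mulrC.
    by move=> mK; rewrite lerD2r ler_wpM2l.
  move/(_ wK)/le_trans; apply; move: (8 * _ * _) K0 K1 {wK} => K K0 K1.
  have L1 := ln_ge1 N4; have N0R : 0 < N%:R :> R by rewrite ltr0n.
  have [|h1 h3 /andP[B0 h2]] := @window_bounds p N K (leq_trans j0 jp') N4.
    by rewrite K0 K1.
  set L := ln N%:R in L1 h1 h2 h3 *.
  rewrite /mom2_cst [leRHS]mulrDl; apply: lerD.
    apply: (@le_trans _ _ (17 * (p%:R * N%:R * L) *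
       (33 * (p%:R * N%:R * L) * (65 * (p%:R * L) / N%:R)))).
      apply: ler_pM => //; [lra| |apply: ler_pM => //; lra].
      by apply: mulr_ge0 => //; lra.
    by rewrite le_eqVlt; apply/orP; left; apply/eqP; field; exact: lt0r_neq0.
  have L3 : 1 <= L ^+ 3 by rewrite exprn_ege1.
  have N1 : 1 <= N%:R :> R by rewrite ler1n.
  by rewrite ler_peMr ?mulr_ge0 ?expR_ge0// mulr_ege1.
- move=> X' X'0; have /andP[a1 a2] := mom2_full_bounds R X' jN0.
  rewrite a2 andbT; apply: le_trans a1; rewrite lerD2l lerN2.
  apply: le_trans (tail_le jN0 X'0 a0 b0).
  by rewrite /a -/b -!mulrA (mulrC X'%:R) !mulrA.
Qed.
End SurvivalAsymptotics.

(** * Inclusion-exclusion and the constants of the expansion *)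

Section MinimumAsymptotics.
Variable R : realType.
Implicit Types (N k j m n p X : nat) (x y : R).

Definition incl_excl p j : R := (-1) ^+ j * 'C(p, j.+1)%:R.

(** By (j + 1) C(p, j + 1) = p C(p - 1, j); for f the logarithm or its square this produces
    [p * c_const] and [p * w_const]. *)
Lemma sum_incl_excl p (f : nat -> R) :
  \sum_(j < p) incl_excl p j * f j =
  p%:R * \sum_(j < p) (-1) ^+ j * 'C(p.-1, j)%:R * (f j / j.+1%:R).
Proof.
rewrite mulr_sumr; apply: eq_bigr => j _; rewrite /incl_excl.
have E : p%:R * 'C(p.-1, j)%:R = j.+1%:R * 'C(p, j.+1)%:R :> R.
  by rewrite -!natrM mul_bin_diag.
have j0 : j.+1%:R != 0 :> R by rewrite pnatr_eq0.
have -> : p%:R * ((-1) ^+ j * 'C(p.-1, j)%:R * (f j / j.+1%:R)) =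
    (-1) ^+ j * (p%:R * 'C(p.-1, j)%:R) * (f j / j.+1%:R).
  by move: ((-1) ^+ j) => a; ring.
by rewrite E; move: ((-1) ^+ j) => a; field.
Qed.

Lemma sum_incl_excl1 p : (0 < p)%N -> \sum_(j < p) incl_excl p j = 1.
Proof.
move=> p0; have := survival_expand p (0 : R).
rewrite subr0 expr1n gtn_eqF// addr0 => ->; apply: eq_bigr => j _.
by rewrite expr0n subr0 mulr1.
Qed.

Definition incl_excl_norm p : R := \sum_(j < p) `|incl_excl p j|.

Lemma incl_excl_norm_ge0 p : 0 <= incl_excl_norm p.
Proof. exact: sumr_ge0. Qed.

Lemma incl_excl_dist p (a b : nat -> R) E : (forall j, (j < p)%N -> `|a j - b j| <= E) ->
  `|\sum_(j < p) incl_excl p j * a j - \sum_(j < p) incl_excl p j * b j| <=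
  incl_excl_norm p * E.
Proof.
move=> h; rewrite -sumrB mulr_suml; apply: le_trans (ler_norm_sum _ _ _) _.
by apply: ler_sum => j _; rewrite -mulrBr normrM ler_wpM2l// h.
Qed.

Lemma survival_sum_near p N (v b : nat -> R) B : (0 < p)%N -> (0 < N)%N ->
  (forall k, 0 <= v k) ->
  (forall j, (j < p)%N -> exists C, forall X, (0 < X)%N ->
     `|\sum_(k < X) v k * (1 - full R N k ^+ j.+1) - b j| <= B + C / X%:R) ->
  exists2 x : R, (\sum_(0 <= k <oo) (v k * (1 - full R N k) ^+ p)%:E = x%:E)%E &
    `|x - \sum_(j < p) incl_excl p j * b j| <= incl_excl_norm p * B.
Proof.
move=> p0 N0 v0 h.
have /choice[C hC] : forall j : 'I_p, exists C, forall X, (0 < X)%N ->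
     `|\sum_(k < X) v k * (1 - full R N k ^+ j.+1) - b j| <= B + C / X%:R.
  by move=> j; exact: h.
apply: (@nneseries_near _ _ _ _ (\sum_(j < p) `|incl_excl p j| * C j)).
  by move=> k; rewrite mulr_ge0// exprn_ge0// subr_ge0 full_le1.
move=> X X0.
have -> : \sum_(k < X) v k * (1 - full R N k) ^+ p =
    \sum_(j < p) incl_excl p j * \sum_(k < X) v k * (1 - full R N k ^+ j.+1).
  under [RHS]eq_bigr do rewrite mulr_sumr.
  rewrite exchange_big/=; apply: eq_bigr => k _.
  rewrite survival_expand gtn_eqF// addr0 mulr_sumr; apply: eq_bigr => j _.
  by rewrite mulrCA.
rewrite -sumrB; apply: le_trans (ler_norm_sum _ _ _) _.
rewrite /incl_excl_norm !mulr_suml -big_split/=; apply: ler_sum => j _.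
by rewrite -mulrBr normrM -mulrA -mulrDr ler_wpM2l// hC.
Qed.

(** The summand [ln j.+1%:R], due to the enlargement of the collection, is the origin of the
    logarithms in [c_const] and [w_const]. *)
Lemma harm_scaled N j : (0 < N)%N ->
  `|harm R 1 (j.+1 * N) - (ln N%:R + ln j.+1%:R + euler_gamma R)| <= N%:R^-1.
Proof.
move=> N0; have jN0 : (0 < j.+1 * N)%N by rewrite muln_gt0.
have := harm1_asymp R jN0.
rewrite natrM lnM ?posrE ?ltr0n// (addrC (ln j.+1%:R)) => /le_trans; apply.
by rewrite -natrM lef_pV2 ?posrE ?ltr0n// ler_nat leq_pmull.
Qed.

Lemma survival_mean p : (0 < p)%N -> exists2 K : R, 0 <= K &
  forall N, (p <= N)%N -> (4 <= N)%N ->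
  exists2 x : R, (\sum_(0 <= k <oo) ((1 - full R N k) ^+ p)%:E = x%:E)%E &
  `|x - N%:R * (ln N%:R + euler_gamma R + p%:R * c_const R p)| <= K * ln N%:R ^+ 2.
Proof.
move=> p0; exists (incl_excl_norm p * (mean_cst R p + 1)).
  by rewrite mulr_ge0 ?incl_excl_norm_ge0// !addr_ge0// !mulr_ge0// ?exprn_ge0// expR_ge0.
move=> N pN N4; have N0 : (0 < N)%N by apply: leq_trans N4.
have NR : 0 < N%:R :> R by rewrite ltr0n.
have L1 : 1 <= ln (N%:R : R) ^+ 2 by rewrite exprn_ege1// ln_ge1.
pose b j : R := N%:R * harm R 1 (j.+1 * N).
have [k|j jp|x xE xb] := @survival_sum_near p N (fun=> 1) b (mean_cst R p * ln N%:R ^+ 2) p0 N0.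
- exact: ler01.
- have [C hC] := @power_mean R p N j.+1 jp pN N4.
  exists C => X X0; apply: le_trans (hC X X0).
  have -> : (j.+1 * N)%:R * harm R 1 (j.+1 * N) = j.+1%:R * b j by rewrite /b natrM mulrA.
  under eq_bigr do rewrite mul1r.
  by rewrite -mulrBr normrM ler_peMl// ger0_norm// ler1n.
exists x; first by rewrite -xE; apply: eq_eseriesr => k _; rewrite mul1r.
have -> : N%:R * (ln N%:R + euler_gamma R + p%:R * c_const R p) =
    \sum_(j < p) incl_excl p j * (N%:R * (ln N%:R + ln j.+1%:R + euler_gamma R)).
  rewrite /c_const -(sum_incl_excl p (fun j => ln j.+1%:R)).
  rewrite -[X in N%:R * (X + _)]mul1r -(sum_incl_excl1 p0) mulr_suml -big_split mulr_sumr/=.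
  by apply: eq_bigr => j _; ring.
have := @incl_excl_dist p b (fun j => N%:R * (ln N%:R + ln j.+1%:R + euler_gamma R)) 1.
have h j : (j < p)%N -> `|b j - N%:R * (ln N%:R + ln j.+1%:R + euler_gamma R)| <= 1.
  move=> _; rewrite -mulrBr normrM gtr0_norm//.
  apply: (@le_trans _ _ (N%:R * N%:R^-1)); last by rewrite divff// lt0r_neq0.
  by rewrite ler_wpM2l// harm_scaled.
move=> /(_ h) h1.
rewrite -(subrK (\sum_(j < p) incl_excl p j * b j) x) -addrA.
apply: le_trans (ler_normD _ _) _.
rewrite -mulrA mulrDl mul1r mulrDr lerD//.
by apply: le_trans h1 _; rewrite ler_wpM2l// incl_excl_norm_ge0.
Qed.

Lemma survival_mom2 p : (0 < p)%N -> exists2 K : R, 0 <= K &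
  forall N, (p <= N)%N -> (4 <= N)%N ->
  exists2 x : R, (\sum_(0 <= k <oo) (k.*2.+1%:R * (1 - full R N k) ^+ p)%:E = x%:E)%E &
  `|x - N%:R ^+ 2 * (ln N%:R ^+ 2 + 2 * (euler_gamma R + p%:R * c_const R p) * ln N%:R +
      euler_gamma R ^+ 2 + pi ^+ 2 / 6 + 2 * p%:R * c_const R p * euler_gamma R +
      p%:R * w_const R p)| <= K * (N%:R * ln N%:R ^+ 3).
Proof.
move=> p0; set g := euler_gamma R.
exists (incl_excl_norm p * (mom2_cst R p + (9 + 3 * `|g|))).
  rewrite mulr_ge0 ?incl_excl_norm_ge0// /mom2_cst.
  by rewrite !addr_ge0// !mulr_ge0// ?exprn_ge0// expR_ge0.
move=> N pN N4; have N0 : (0 < N)%N by apply: leq_trans N4.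
have NR : 0 < N%:R :> R by rewrite ltr0n.
have N1 : 1 <= N%:R :> R by rewrite ler1n.
set L := ln (N%:R : R); have L1 : 1 <= L by exact: ln_ge1.
have L3 : L <= L ^+ 3 by rewrite [leRHS]exprS ler_peMr ?exprn_ege1//; lra.
pose b j : R := mom2 R (j.+1 * N) (j.+1 * N) / j.+1%:R ^+ 2.
have [k|j jp|x xE xb] := @survival_sum_near p N (fun k => k.*2.+1%:R) b
    (mom2_cst R p * (N%:R * L ^+ 3)) p0 N0.
- by [].
- have [C hC] := @power_mom2 R p N j.+1 jp pN N4.
  exists C => X X0; apply: le_trans (hC X X0).
  have j1 : j.+1%:R ^+ 2 != 0 :> R by rewrite expf_neq0// pnatr_eq0.
  have -> : mom2 R (j.+1 * N) (j.+1 * N) = j.+1%:R ^+ 2 * b j by rewrite /b mulrC divfK.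
  rewrite -mulrBr normrM ler_peMl// ger0_norm ?exprn_ge0// exprn_ege1//.
  by rewrite ler1n.
exists x; first exact: xE.
pose b' j := N%:R ^+ 2 * ((L + ln j.+1%:R + g) ^+ 2 + pi ^+ 2 / 6).
set target := N%:R ^+ 2 * _.
have -> : target = \sum_(j < p) incl_excl p j * b' j.
  have c1 := sum_incl_excl p (fun j => ln j.+1%:R : R).
  have c2 := sum_incl_excl p (fun j => ln j.+1%:R ^+ 2 : R).
  rewrite /target /c_const /w_const.
  have -> : \sum_(j < p) incl_excl p j * b' j =
     N%:R ^+ 2 * (((L + g) ^+ 2 + pi ^+ 2 / 6) * (\sum_(j < p) incl_excl p j) +
       2 * (L + g) * (\sum_(j < p) incl_excl p j * ln j.+1%:R) +
       \sum_(j < p) incl_excl p j * ln j.+1%:R ^+ 2).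
    rewrite !mulr_sumr -!big_split mulr_sumr/=.
    by apply: eq_bigr => j _; rewrite /b'; ring.
  by rewrite sum_incl_excl1// c1 c2; ring.
have := @incl_excl_dist p b b' ((9 + 3 * `|g|) * (N%:R * L)).
have h j : (j < p)%N -> `|b j - b' j| <= (9 + 3 * `|g|) * (N%:R * L).
  move=> jp; have jN0 : (0 < j.+1 * N)%N by rewrite muln_gt0.
  have hH := harm_scaled j N0; have hH2 := harm2_asymp R jN0.
  have {}hH2 : `|harm R 2 (j.+1 * N) - pi ^+ 2 / 6| <= N%:R^-1.
    by apply: le_trans hH2 _; rewrite lef_pV2 ?posrE ?ltr0n// ler_nat leq_pmull.
  have l0 : 0 <= ln (j.+1%:R : R) by rewrite ln_ge0// ler1n.
  have lL : ln (j.+1%:R : R) <= L.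
    by rewrite ler_ln ?posrE ?ltr0n// ler_nat (leq_trans jp).
  have H0 := harm_ge0 R 1 (j.+1 * N).
  (* Each of the three pieces is O(N ln N), below the scaling error: harmonic numbers are known up
     to 1 / N, and the last piece is the linear term of [mom2]. *)
  have -> : b j - b' j =
     N%:R ^+ 2 * (harm R 1 (j.+1 * N) ^+ 2 - (L + ln j.+1%:R + g) ^+ 2) +
     N%:R ^+ 2 * (harm R 2 (j.+1 * N) - pi ^+ 2 / 6) -
     N%:R * harm R 1 (j.+1 * N) / j.+1%:R.
    rewrite /b /b' /mom2 natrM.
    have : j.+1%:R != 0 :> R by rewrite pnatr_eq0.
    by move: j.+1%:R (ln _) (harm _ 1 _) (harm _ 2 _) => q l u v q0; field.
  move: (harm R 1 _) (harm R 2 _) hH hH2 H0 => H H2 hH hH2 H0.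
  set h := L + ln j.+1%:R + g in hH *.
  have g0 : 0 <= `|g| by [].
  have gL : `|g| <= `|g| * L by rewrite ler_peMr.
  have hb : `|h| <= (2 + `|g|) * L.
    apply: le_trans (ler_normD _ _) _.
    rewrite ger0_norm; first by rewrite mulrDl lerD//; lra.
    by rewrite addr_ge0//; lra.
  have Ni : N%:R^-1 <= 1 :> R by rewrite invf_le1.
  have Hb : H <= (3 + `|g|) * L.
    have -> : H = (H - h) + h by rewrite subrK.
    apply: le_trans (ler_norm _) _; apply: le_trans (ler_normD _ _) _.
    have -> : (3 + `|g|) * L = L + (2 + `|g|) * L by ring.
    by rewrite lerD// (le_trans hH)// (le_trans Ni).
  have Hh : `|H + h| <= (5 + 2 * `|g|) * L.
    have -> : (5 + 2 * `|g|) * L = (3 + `|g|) * L + (2 + `|g|) * L by ring.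
    by apply: le_trans (ler_normD _ _) _; rewrite lerD// ger0_norm.
  have -> : (9 + 3 * `|g|) * (N%:R * L) = (5 + 2 * `|g|) * L * N%:R + N%:R * L +
    N%:R * ((3 + `|g|) * L) by ring.
  apply: le_trans (ler_normB _ _) _; apply: lerD.
    apply: le_trans (ler_normD _ _) _; apply: lerD.
      have -> : H ^+ 2 - h ^+ 2 = (H - h) * (H + h) by ring.
      rewrite !normrM ger0_norm ?exprn_ge0//.
      have -> : (5 + 2 * `|g|) * L * N%:R = N%:R ^+ 2 * (N%:R^-1 * ((5 + 2 * `|g|) * L)).
        by field; exact: lt0r_neq0.
      by rewrite ler_wpM2l ?exprn_ge0// ler_pM.
    rewrite normrM ger0_norm ?exprn_ge0//.
    apply: (@le_trans _ _ (N%:R ^+ 2 * N%:R^-1)); first by rewrite ler_wpM2l ?exprn_ge0.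
    by rewrite expr2 mulfK ?lt0r_neq0// ler_peMr.
  rewrite ger0_norm; last by rewrite !mulr_ge0// invr_ge0.
  rewrite -mulrA ler_wpM2l//; apply: le_trans Hb.
  by rewrite ler_pdivrMr// ler_peMr// ler1n.
move=> /(_ h) h1.
rewrite -(subrK (\sum_(j < p) incl_excl p j * b j) x) -addrA.
apply: le_trans (ler_normD _ _) _.
rewrite -mulrA mulrDl mulrDr lerD//.
apply: le_trans h1 _; rewrite ler_wpM2l ?incl_excl_norm_ge0//.
rewrite ler_wpM2l ?addr_ge0 ?mulr_ge0// ler_wpM2l//.
Qed.
End MinimumAsymptotics.

(** * The minimum of independent collection times *)

Section MinimumLaw.
Variable R : realType.

Lemma variance_fin (d : measure_display) (Om : measurableType d) (P : probability Om R)
    (X : Om -> R) (x1 x2 : R) : measurable_fun setT X ->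
  ('E_P[X] = x1%:E -> 'E_P[(X ^+ 2)%R] = x2%:E -> 'V_P[X] = (x2 - x1 ^+ 2)%R%:E)%E.
Proof.
move=> mX e1 e2; rewrite varianceE ?e1 ?e2//.
rewrite inE; apply/andP; split; first by rewrite inE.
rewrite inE /= /finite_norm unlock poweR_lty//.
have -> : (\int[P]_x (`|(EFin \o X) x| `^ 2) = 'E_P[(X ^+ 2)%R])%E.
  rewrite unlock; apply: eq_integral => w _.
  by rewrite /= powR_mulrn// real_normK// num_real.
by rewrite e2 ltry.
Qed.

Lemma measurable_bigmin (d : measure_display) (Om : measurableType d) (I : Type)
    (s : seq I) (f0 : Om -> R) (f : I -> Om -> R) :
  measurable_fun setT f0 -> (forall i, measurable_fun setT (f i)) ->
  measurable_fun setT (fun w => \big[Num.min/f0 w]_(i <- s) f i w).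
Proof.
move=> m0 mf; elim: s => [|i s IHs]; first by under eq_fun do rewrite big_nil.
by under eq_fun do rewrite big_cons; apply: measurable_minr.
Qed.

Section FixedN.
Context (d : measure_display) (Om : measurableType d) (P : probability Om R).
Variables (N p : nat) (hp : (0 < p)%N) (T : 'I_p -> {RV P >-> R}).
Hypotheses (N0 : (0 < N)%N) (hlaw : forall i, has_collection_law N (T i))
  (hind : mutually_independent P (fun i => [set T i @^-1` B | B in measurable])).

Let M := min_rv hp T.

Lemma measurable_min_rv : measurable_fun setT M.
Proof. exact: measurable_bigmin. Qed.

Lemma min_rv_gt k : P [set w | k%:R < M w] = ((1 - full R N k) ^+ p)%:E.
Proof.
pose J := [fset i | i in enum 'I_p]%fset.
pose B := [set x : R | k%:R < x].
have mB : measurable B.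
  have -> : B = [set` `]k%:R, +oo[] by apply/seteqP; split => x; rewrite /B /= in_itv/= andbT.
  exact: measurable_itv.
have -> : [set w | k%:R < M w] = \bigcap_(i in [set` J]) (T i @^-1` B).
  apply/seteqP; split => w /=; first by move=> /bigmin_gtP[_ h] i _; exact: h.
  by move=> h; apply/bigmin_gtP; split => [|i _]; apply: h; rewrite /= !inE mem_enum.
rewrite hind; last by move=> i _; exists B.
rewrite (eq_bigr (fun=> (1 - full R N k)%:E)) => [|i _]; last exact: collection_law_gt.
by rewrite prode_const card_fseq undup_id ?enum_uniq// size_enum_ord.
Qed.

Lemma min_rv_natural : {ae P, forall w, exists n : nat, M w = n%:R}.
Proof.
have : {ae P, forall w, forall i, @naturals R (T i w)}.
  apply: filter_forall => i; apply: (@ae_prob1 _ _ _ _ (T i @^-1` @naturals R)).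
    by rewrite -[X in measurable X]setTI; apply: measurable_funPT => //; exact: measurable_naturals.
  exact: collection_law_naturals (hlaw i).
apply: filterS => w h; rewrite /M /min_rv.
elim/big_rec: _ => [|i x _ [n ->]]; first by have [n _ <-] := h (Ordinal hp); exists n.
by have [m _ <-] := h i; rewrite minEle; case: ifP => _; [exists m|exists n].
Qed.

Lemma expectation_min_rv :
  ('E_P[M] = \sum_(0 <= k <oo) ((1 - full R N k) ^+ p)%R%:E)%E.
Proof.
rewrite (@expectation_tail_series _ _ _ P M M (fun=> 1)) //.
- by apply: eq_eseriesr => k _; rewrite mul1e min_rv_gt.
- exact: measurable_min_rv.
- exact: measurable_min_rv.
- apply: filterS min_rv_natural => w [n Mn]; exists n.
  by rewrite sumr_const card_ord.
Qed.

Lemma expectation_min_rv_sqr : ('E_P[(M ^+ 2)%R] =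
  \sum_(0 <= k <oo) (k.*2.+1%:R * (1 - full R N k) ^+ p)%R%:E)%E.
Proof.
rewrite (@expectation_tail_series _ _ _ P M _ (fun k => k.*2.+1%:R)) //.
- by apply: eq_eseriesr => k _; rewrite min_rv_gt EFinM.
- exact: measurable_min_rv.
- have -> : M ^+ 2 = (fun w => M w ^+ 2) by [].
  by apply: measurable_funX; exact: measurable_min_rv.
- apply: filterS min_rv_natural => w [n Mn]; exists n; split => //.
  have -> : (M ^+ 2) w = n%:R ^+ 2 by rewrite -Mn.
  by have := sum_odd_block R 0 n; rewrite add0n expr0n subr0 => <-.
Qed.

Lemma expectation_min_rv_fin : exists2 x : R, ('E_P[M] = x%:E)%E & 0 <= x.
Proof.
have [k||x xE xA] := @nneseries_near R (fun k => (1 - full R N k) ^+ p) 0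
    (N%:R * harm R 1 N) 0.
- by rewrite exprn_ge0// subr_ge0 full_le1.
- move=> X _; rewrite subr0 mul0r addr0 ger0_norm; last first.
    by apply: sumr_ge0 => k _; rewrite exprn_ge0// subr_ge0 full_le1.
  have /andP[_] := mean_full_bounds R X N0; apply: le_trans.
  apply: ler_sum => k _; have f0 := full_ge0 R N k; have f1 := full_le1 R k N0.
  by rewrite -(prednK hp) exprS ler_piMr ?subr_ge0// exprn_ile1// ?subr_ge0//; lra.
exists x; first by rewrite expectation_min_rv.
rewrite -lee_fin -xE; apply: nneseries_ge0 => k _ _.
by rewrite lee_fin exprn_ge0// subr_ge0 full_le1.
Qed.

Lemma expectation_min_rv_sqr_fin : exists x : R, ('E_P[(M ^+ 2)%R] = x%:E)%E.
Proof.
have [k||x xE xA] := @nneseries_near R (fun k => k.*2.+1%:R * (1 - full R N k) ^+ p) 0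
    (mom2 R N N) 0.
- by rewrite mulr_ge0// exprn_ge0// subr_ge0 full_le1.
- move=> X _; rewrite subr0 mul0r addr0 ger0_norm; last first.
    by apply: sumr_ge0 => k _; rewrite mulr_ge0// exprn_ge0// subr_ge0 full_le1.
  have /andP[_] := mom2_full_bounds R X N0; apply: le_trans.
  apply: ler_sum => k _; have f0 := full_ge0 R N k; have f1 := full_le1 R k N0.
  rewrite ler_wpM2l// -(prednK hp) exprS ler_piMr ?subr_ge0// exprn_ile1// ?subr_ge0//; lra.
by exists x; rewrite expectation_min_rv_sqr.
Qed.

Lemma min_rv_increment a b : (a <= b)%N ->
  (1 - full R N a) ^+ p - (1 - full R N b) ^+ p <= p%:R * (b%:R - a%:R) / N%:R.
Proof.
move=> ab; apply: le_trans (ler_norm _) _.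
have f01 k : 0 <= 1 - full R N k <= 1.
  by have f0 := full_ge0 R N k; have f1 := full_le1 R k N0; apply/andP; split; lra.
apply: le_trans (ler_norm_subX p (f01 a) (f01 b)) _.
rewrite -mulrA ler_wpM2l//.
have -> : 1 - full R N a - (1 - full R N b) = full R N b - full R N a by ring.
rewrite ger0_norm ?subr_ge0 ?full_homo//.
by rewrite -natrB// -{1}(subnKC ab) full_lipschitz.
Qed.

(* Each value of [M] has probability at most [p / N], so [M] cannot concentrate
   on a window of length [o(N)]. *)
Lemma variance_min_rv_ge x1 v : (8 * p <= N)%N -> 0 <= x1 ->
  ('E_P[M] = x1%:E)%E -> ('V_P[M] = v%:E)%E -> (128 * p%:R ^+ 2)^-1 * N%:R ^+ 2 <= v.
Proof.
move=> pN x10 e1 ev; have NR : 0 < N%:R :> R by rewrite ltr0n.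
have pR : 0 < p%:R :> R by rewrite ltr0n.
(* The window of half-width [eps] then has mass at most p (2 eps + 2) / N = 1/4 + 2 p / N, which is
   at most 1/2 as 8 p <= N. Chebyshev gives v >= eps^2 / 2 = N^2 / (128 p^2). *)
pose eps : R := N%:R / (8 * p%:R).
have eps0 : 0 < eps by rewrite divr_gt0// mulr_gt0.
pose X : {RV P >-> R} := HB.pack M (isMeasurableFun.Build _ _ _ _ M measurable_min_rv).
have := @chebyshev _ _ R P X eps eps0.
rewrite (_ : (X : Om -> R) = M)// e1 ev /=.
pose A k := [set w | k%:R < M w].
have mA k : measurable (A k).
  rewrite -[A k]setTI; have -> : A k = M @^-1` [set` `]k%:R, +oo[].
    by apply/seteqP; split => w; rewrite /A /= in_itv/= andbT.
  exact: measurable_min_rv.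
have PA k : P (A k) = ((1 - full R N k) ^+ p)%:E := min_rv_gt k.
pose C := [set w | `|M w - x1| < eps].
have mC : measurable C.
  rewrite -[C]setTI; have -> : C = M @^-1` [set` `]x1 - eps, x1 + eps[].
    by apply/seteqP; split => w; rewrite /C /= in_itv/= ltr_distl.
  exact: measurable_min_rv.
have -> : [set x | eps <= `|M x - x1|] = ~` C.
  by apply/seteqP; split => w /=; rewrite leNgt => /negP.
have window : (P C <= (p%:R * (2 * eps + 2) / N%:R)%:E)%E.
  (* Rounding both ends of the window outwards to integers lengthens it by at most 2, whence 2 eps +
     2. *)
  pose hi := (Num.truncn (x1 + eps)).+1.
  have b0 : 0 <= x1 + eps by lra.
  have /andP[hi1 hi2] := truncn_itv b0.
  have hiE : hi%:R = (Num.truncn (x1 + eps))%:R + 1 :> R by rewrite -natr1.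
  have incr lo : (lo <= hi)%N -> hi%:R - lo%:R <= 2 * eps + 2 ->
      (1 - full R N lo) ^+ p - (1 - full R N hi) ^+ p <= p%:R * (2 * eps + 2) / N%:R.
    move=> lh h; apply: le_trans (min_rv_increment lh) _.
    by rewrite ler_wpM2r ?invr_ge0// ler_wpM2l// ltW.
  have [a0|a0] := leP 0 (x1 - eps).
    have /andP[lo1 lo2] := truncn_itv a0; set lo := Num.truncn (x1 - eps) in lo1 lo2.
    have loE : lo.+1%:R = lo%:R + 1 :> R by rewrite -natr1.
    have lh : (lo <= hi)%N by rewrite -(ler_nat R) hiE; lra.
    apply: (@le_trans _ _ (P (A lo `\` A hi))).
      apply: le_measure; rewrite ?inE//; first exact: measurableD.
      move=> w; rewrite /C /A /= ltr_distl => /andP[w1 w2]; split; first by lra.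
      by apply/negP; rewrite -leNgt; lra.
    rewrite measureD//; last by apply: le_lt_trans (probability_le1 P (mA lo)) _; exact: ltry.
    have -> : A lo `&` A hi = A hi.
      apply/setIidPr => w; rewrite /A /=; apply: le_lt_trans.
      by rewrite ler_nat.
    rewrite [X in (X - _)%E]PA [X in (_ - X)%E]PA -EFinB lee_fin.
    by apply: incr => //; lra.
  (* A window reaching below 0 is treated with lower end 0, where F vanishes and the survival
     function is 1. *)
  apply: (@le_trans _ _ (P (~` A hi))).
    apply: le_measure; rewrite ?inE//; first exact: measurableC.
    move=> w; rewrite /C /A /= ltr_distl => /andP[w1 w2].
    by apply/negP; rewrite -leNgt; lra.
  rewrite probability_setC// PA -EFinB lee_fin.
  have f0 : full R N 0 = 0 by rewrite /full/= gtn_eqF.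
  have := incr 0%N (leq0n _); rewrite f0 !subr0 expr1n.
  by apply; lra.
rewrite probability_setC//.
have half : p%:R * (2 * eps + 2) / N%:R <= 2^-1.
  rewrite ler_pdivrMr// /eps.
  have -> : p%:R * (2 * (N%:R / (8 * p%:R)) + 2) = N%:R / 4 + 2 * p%:R :> R.
    by field; exact: lt0r_neq0.
  have : 8 * p%:R <= N%:R :> R by rewrite -natrM ler_nat.
  lra.
have [q qE] : exists q, P C = q%:E.
  by exists (fine (P C)); rewrite fineK//; exact: fin_num_measure.
rewrite qE -EFinB -EFinM lee_fin; move: window; rewrite qE lee_fin => qw h.
have {}h : 2^-1 <= eps ^- 2 * v by lra.
move: h; rewrite -ler_pdivrMl ?invr_gt0 ?exprn_gt0// invrK; apply: le_trans.
rewrite le_eqVlt; apply/orP; left; apply/eqP; rewrite /eps.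
by field; exact: lt0r_neq0.
Qed.

End FixedN.

(** With L = ln N, N = exp L >= L^4 / 4!, so the quotient is at most 24 / L. *)
Lemma cvg_ln3_div : ln (N%:R : R) ^+ 3 / N%:R @[N --> \oo] --> (0 : R).
Proof.
have lny : ln (N%:R : R) @[N --> \oo] --> +oo.
  apply/cvgryPge => A; near=> N.
  have h : expR A <= N%:R by near: N; exact: nbhs_infty_ger.
  rewrite -[A]expRK ler_ln ?posrE ?expR_gt0//.
  exact: lt_le_trans (expR_gt0 A) h.
apply: (@squeeze_cvgr _ _ _ _ (fun=> 0) (fun N => 24 * (ln (N%:R : R))^-1)).
- near=> N.
  have N4 : (4 <= N)%N by near: N; exact: nbhs_infty_ge.
  have L1 := ln_ge1 R N4; have N0 : 0 < N%:R :> R by rewrite ltr0n (leq_trans _ N4).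
  set L := ln _ in L1 *; have L0 : 0 < L by lra.
  rewrite divr_ge0 ?exprn_ge0//=; last exact: ltW.
  rewrite ler_pdivrMr// mulrAC ler_pdivlMr// -exprSr.
  have := @expR_ge1Dxn R L 3 (ltW L0); rewrite lnK ?posrE// -[4`!]/24%N => h.
  rewrite -ler_pdivrMl// mulrC; apply: le_trans h.
  by rewrite lerDr.
- exact: cvg_cst.
- rewrite -(mulr0 24); apply: cvgMr.
  apply/gtr0_cvgV0 => //.
  near=> N; apply: lt_le_trans (ln_ge1 R _) => //; near: N; exact: nbhs_infty_ge.
Unshelve. all: by end_near. Qed.
End MinimumLaw.

(** * Limit of the normalised variance *)

Section VarianceLimit.
Variable R : realType.

(** Here y stands for ln N and x for the mean: squaring multiplies its relative error y^2 / N by a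
    quantity of order y, which reaches y^3 / N, the order already present in the second moment. *)
Lemma sqr_ratio_near (x a y B N : R) : 0 < N -> 1 <= y -> y ^+ 2 <= N * y ->
  `|a| <= B * y -> forall K, 0 <= K -> `|x - N * a| <= K * y ^+ 2 ->
  `|(x / N) ^+ 2 - a ^+ 2| <= K * (2 * B + K) * (y ^+ 3 / N).
Proof.
move=> N0 y1 yN aB K K0 h; have N_neq0 := lt0r_neq0 N0.
have y0 : 0 <= y by lra.
have d1 : `|x / N - a| <= K * (y ^+ 2 / N).
  have -> : x / N - a = (x - N * a) / N by field.
  by rewrite normrM (gtr0_norm (x := N^-1)) ?invr_gt0// mulrA ler_wpM2r// invr_ge0 ltW.
have d2 : y ^+ 2 / N <= y by rewrite ler_pdivrMr// mulrC.
have d3 : `|x / N + a| <= (2 * B + K) * y.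
  have -> : x / N + a = (x / N - a) + 2 * a by ring.
  apply: le_trans (ler_normD _ _) _; rewrite normrM (ger0_norm (x := 2))//.
  have : K * (y ^+ 2 / N) <= K * y by rewrite ler_wpM2l.
  lra.
have -> : (x / N) ^+ 2 - a ^+ 2 = (x / N - a) * (x / N + a) by ring.
have -> : K * (2 * B + K) * (y ^+ 3 / N) = (K * (y ^+ 2 / N)) * ((2 * B + K) * y).
  by field.
by rewrite normrM ler_pM.
Qed.

(** The square of ln N + gamma + p c cancels every term of the second moment that involves ln N, and
    both errors O((ln N)^3 / N) vanish. *)
Lemma variance_survival_cvg (p : nat) (x1 x2 : nat -> R) : (0 < p)%N ->
  (forall N, (0 < N)%N ->
     (\sum_(0 <= k <oo) ((1 - full R N k) ^+ p)%:E = (x1 N)%:E)%E) ->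
  (forall N, (0 < N)%N ->
     (\sum_(0 <= k <oo) (k.*2.+1%:R * (1 - full R N k) ^+ p)%:E = (x2 N)%:E)%E) ->
  (x2 N - x1 N ^+ 2) / N%:R ^+ 2 @[N --> \oo] -->
  pi ^+ 2 / 6 + p%:R * w_const R p - p%:R ^+ 2 * c_const R p ^+ 2.
Proof.
move=> p0 x1E x2E.
have [K1 K10 h1] := survival_mean R p0; have [K2 K20 h2] := survival_mom2 R p0.
set g := euler_gamma R in h1 h2; set c := c_const R p in h1 h2 *.
set w := w_const R p in h2 *; set v := _ - _.
pose B := 1 + `|g + p%:R * c|.
pose K := K2 + K1 * (2 * B + K1).
have bound N : (p <= N)%N -> (4 <= N)%N ->
    `|(x2 N - x1 N ^+ 2) / N%:R ^+ 2 - v| <= K * (ln N%:R ^+ 3 / N%:R).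
  move=> pN N4; have N0 : (0 < N)%N by apply: leq_trans N4.
  have NR : 0 < N%:R :> R by rewrite ltr0n.
  have NR0 := lt0r_neq0 NR.
  have L1 := ln_ge1 R N4; have LN := ln_sublinear NR.
  have [y1 y1E y1b] := h1 N pN N4; have [y2 y2E y2b] := h2 N pN N4.
  have e1 : y1 = x1 N by apply: EFin_inj; rewrite -y1E x1E.
  have e2 : y2 = x2 N by apply: EFin_inj; rewrite -y2E x2E.
  move: y1b y2b; rewrite {}e1 {}e2; set L := ln N%:R in L1 LN *.
  move: (x1 N) (x2 N) => X1 X2 y1b y2b {y1E y2E}.
  have aB : `|L + g + p%:R * c| <= B * L.
    rewrite -addrA; apply: le_trans (ler_normD _ _) _.
    rewrite /B mulrDl mul1r ger0_norm; last by lra.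
    by rewrite lerD2l ler_peMr.
  have LL : L ^+ 2 <= N%:R * L by rewrite expr2 ler_wpM2r// ?ltW//; lra.
  have q1 := sqr_ratio_near NR L1 LL aB K10 y1b.
  set b := (X in X2 - N%:R ^+ 2 * X) in y2b.
  have q2 : `|X2 / N%:R ^+ 2 - b| <= K2 * (L ^+ 3 / N%:R).
    have -> : X2 / N%:R ^+ 2 - b = (X2 - N%:R ^+ 2 * b) / N%:R ^+ 2 by field.
    rewrite normrM (gtr0_norm (x := (_ ^+ 2)^-1)) ?invr_gt0 ?exprn_gt0//.
    rewrite ler_pdivrMr ?exprn_gt0//; apply: le_trans y2b _.
    by rewrite le_eqVlt; apply/orP; left; apply/eqP; field.
  have -> : (X2 - X1 ^+ 2) / N%:R ^+ 2 - v =
      (X2 / N%:R ^+ 2 - b) - ((X1 / N%:R) ^+ 2 - (L + g + p%:R * c) ^+ 2).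
    by rewrite /v /b; field.
  by apply: le_trans (ler_normB _ _) _; rewrite /K mulrDl lerD.
have cK : K * (ln (N%:R : R) ^+ 3 / N%:R) @[N --> \oo] --> 0.
  by rewrite -(mulr0 K); apply: cvgMr; exact: cvg_ln3_div.
rewrite -[v]addr0; apply/subr_cvg0; rewrite addr0.
apply/norm_cvg0P.
apply: (@squeeze_cvgr _ _ _ _ (fun=> 0) (fun N : nat => K * (ln (N%:R : R) ^+ 3 / N%:R))) => //.
  near=> N; rewrite normr_ge0/=; apply: bound; near: N; exact: nbhs_infty_ge.
exact: cvg_cst.
Unshelve. all: by end_near. Qed.
End VarianceLimit.

Theorem theorem2p2 (R : realType) (p : nat) (hp : (0 < p)%N)
    (d : nat -> measure_display) (Om : forall N : nat, measurableType (d N))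
    (P : forall N : nat, probability (Om N) R)
    (T : forall N : nat, 'I_p -> {RV (P N) >-> R})
    (hlaw : forall N : nat, (0 < N)%N ->
       forall i : 'I_p, has_collection_law N (T N i))
    (hind : forall N : nat, (0 < N)%N ->
       mutually_independent (P N)
         (fun i : 'I_p => [set T N i @^-1` B | B in measurable])) :
  let M (N : nat) : Om N -> R := min_rv hp (T N) in
  let g : R := euler_gamma R in
  let c : R := c_const R p in
  let w : R := w_const R p in
  [/\ forall N : nat, (0 < N)%N ->
        ('E_(P N)[(M N ^+ 2)%R] =
         2%:E * (\sum_(0 <= k <oo)
           (k%:R * (1 - (stirling2 k N)%:R * (N`!)%:R / N%:R ^+ k) ^+ p)%:E)
         + 'E_(P N)[M N])%E,
      exists e : nat -> R,
        e =O_\oo (fun N : nat => ln N%:R ^+ 3 / N%:R : R) /\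
        forall N : nat, (0 < N)%N ->
          'E_(P N)[(M N ^+ 2)%R]%E =
          (N%:R ^+ 2 *
             (ln N%:R ^+ 2 + 2 * (g + p%:R * c) * ln N%:R
              + g ^+ 2 + pi ^+ 2 / 6 + 2 * p%:R * c * g + p%:R * w + e N))%:E
    & (fun N : nat => fine ('V_(P N)[M N]%E) /
         ((pi ^+ 2 / 6 + p%:R * w - p%:R ^+ 2 * c ^+ 2) * N%:R ^+ 2))
        @ \oo --> (1 : R)].
Proof.
move=> M g c w.
have EM1 N (N0 : (0 < N)%N) := expectation_min_rv hp N0 (hlaw N N0) (hind N N0).
have EM2 N (N0 : (0 < N)%N) := expectation_min_rv_sqr hp N0 (hlaw N N0) (hind N N0).
pose x1 N := fine ('E_(P N)[M N])%E; pose x2 N := fine ('E_(P N)[(M N ^+ 2)%R])%E.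
have Ex1 N : (0 < N)%N -> ('E_(P N)[M N] = (x1 N)%:E)%E /\ 0 <= x1 N.
  move=> N0; have [x xE x0] := expectation_min_rv_fin hp N0 (hlaw N N0) (hind N N0).
  by rewrite /x1 xE.
have Ex2 N : (0 < N)%N -> ('E_(P N)[(M N ^+ 2)%R] = (x2 N)%:E)%E.
  move=> N0; have [x xE] := expectation_min_rv_sqr_fin hp N0 (hlaw N N0) (hind N N0).
  by rewrite /x2 xE.
have EV N : (0 < N)%N -> ('V_(P N)[M N] = (x2 N - x1 N ^+ 2)%R%:E)%E.
  move=> N0; apply: variance_fin; last exact: Ex2.
    exact: measurable_min_rv.
  by have [] := Ex1 N N0.
split.
- move=> N N0; rewrite EM2// EM1//.
  have s0 k : 0 <= (1 - full R N k) ^+ p by rewrite exprn_ge0// subr_ge0 full_le1.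
  rewrite -nneseriesZl; last by move=> k _; rewrite lee_fin -fullE_stirling// mulr_ge0.
  rewrite -nneseriesD; last 2 first.
  + by move=> k _ _; rewrite mule_ge0// lee_fin -fullE_stirling// mulr_ge0.
  + by move=> k _ _; rewrite lee_fin.
  apply: eq_eseriesr => k _; rewrite -fullE_stirling// -EFinM -EFinD; congr (_%:E).
  by rewrite -muln2 -natr1 natrM; ring.
- pose target N := ln N%:R ^+ 2 + 2 * (g + p%:R * c) * ln N%:R
     + g ^+ 2 + pi ^+ 2 / 6 + 2 * p%:R * c * g + p%:R * w : R.
  (* Defined as the exact remainder, so that the expansion holds for every N >= 1; only the bound on
     it asks for N >= p and N >= 4. *)
  exists (fun N => x2 N / N%:R ^+ 2 - target N); split.
    have [K K0 h] := survival_mom2 R hp.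
    apply/eqO_exP; exists (K + 1); first by rewrite ltr_wpDl.
    near=> N.
    have N4 : (4 <= N)%N by near: N; exact: nbhs_infty_ge.
    have pN : (p <= N)%N by near: N; exact: nbhs_infty_ge.
    have N0 : (0 < N)%N by apply: leq_trans N4.
    have NR : 0 < N%:R :> R by rewrite ltr0n.
    have NR0 := lt0r_neq0 NR.
    have [x xE xb] := h N pN N4.
    have {}xE : x = x2 N by apply: EFin_inj; rewrite -xE -Ex2// EM2.
    rewrite {x}xE in xb.
    have L0 : 0 <= ln (N%:R : R) ^+ 3 / N%:R.
      by rewrite divr_ge0 ?exprn_ge0// ?ltW//; apply: lt_le_trans (ln_ge1 R N4).
    rewrite (ger0_norm L0); apply: (@le_trans _ _ (K * (ln N%:R ^+ 3 / N%:R))); last first.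
      by rewrite ler_wpM2r// lerDl.
    have -> : x2 N / N%:R ^+ 2 - target N = (x2 N - N%:R ^+ 2 * target N) / N%:R ^+ 2.
      by field.
    rewrite normrM (gtr0_norm (x := (_ ^+ 2)^-1)) ?invr_gt0 ?exprn_gt0//.
    rewrite ler_pdivrMr ?exprn_gt0//; apply: le_trans xb _.
    by rewrite le_eqVlt; apply/orP; left; apply/eqP; field.
  move=> N N0; rewrite Ex2//; congr (_%:E).
  have NR0 : N%:R != 0 :> R by rewrite pnatr_eq0 -lt0n.
  by rewrite -/(target N) addrC subrK mulrC divfK// expf_neq0.
- have cV : (x2 N - x1 N ^+ 2) / N%:R ^+ 2 @[N --> \oo] -->
      pi ^+ 2 / 6 + p%:R * w - p%:R ^+ 2 * c ^+ 2.
    apply: (variance_survival_cvg hp) => N N0.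
      by rewrite -(Ex1 N N0).1 EM1.
    by rewrite -Ex2// EM2.
  set v := pi ^+ 2 / 6 + _ - _ in cV *.
  (* The equivalence divides by [v]; its positivity is read off the variance bound, in the limit,
     rather than off the alternating sums. *)
  have v0 : 0 < v.
    apply: (@lt_le_trans _ _ (128 * p%:R ^+ 2)^-1).
      by rewrite invr_gt0 mulr_gt0// exprn_gt0// ltr0n.
    apply: (@ler_cvg_to _ \oo _ R (fun=> (128 * p%:R ^+ 2)^-1) _ _ _ _ cV).
      exact: cvg_cst.
    near=> N; have N0 : (0 < N)%N by near: N; exact: nbhs_infty_gt.
    have [e1 x10] := Ex1 N N0.
    rewrite ler_pdivlMr ?exprn_gt0 ?ltr0n//.
    apply: (variance_min_rv_ge N0 (hlaw N N0) (hind N N0) _ x10 e1 (EV N N0)).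
    by near: N; exact: nbhs_infty_ge.
  have : (x2 N - x1 N ^+ 2) / N%:R ^+ 2 / v @[N --> \oo] --> v / v by exact: cvgMl.
  rewrite divff ?lt0r_neq0//; apply: cvg_trans; apply: near_eq_cvg; near=> N.
  have N0 : (0 < N)%N by near: N; exact: nbhs_infty_gt.
  have NR0 : N%:R != 0 :> R by rewrite pnatr_eq0 -lt0n.
  rewrite EV//=; move: (lt0r_neq0 v0); move: v {v0 cV} => q q0.
  by field; rewrite q0 NR0.
Unshelve. all: by end_near. Qed.
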